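(* Suppose that $b$ and $\sigma$ satisfy the following conditions. (i) There exist constants $K_1,K_2>0$ such that for all $x,y\in\mathbb{R}^d$ and $\mu,\nu\in\mathcal{P}_2(\mathbb{R}^d)$, $$2\langle x-y,b(x,\mu)-b(y,\nu)\rangle+\|\sigma(x,\mu)-\sigma(y,\nu)\|^2\leq -K_1|x-y|^2+K_2\mathbb{W}_2(\mu,\nu)^2.$$ (ii) There exists a constant $C>0$ such that $|b(0,\mu)|+\|\sigma(0,\mu)\|\leq C$ for all $\mu\in\mathcal{P}_2(\mathbb{R}^d)$. (iii) There exist constants $\tilde c_1,\tilde c_2,h_1,h_2>0$ such that for all $x\in\mathbb{R}^d$ and $\mu\in\mathcal{P}_2(\mathbb{R}^d)$, $$2\langle x,b(x,\mu)\rangle\leq-\tilde c_1|x|^2+\tilde c_2\mathcal{W}_2(\mu)^2,\qquad m\|\sigma(x,\mu)\|^2\leq h_1|x|^2+h_2\mathcal{W}_2(\mu)^2,$$ where $m$ is the dimension of the Brownian motion. Assume $\tilde c_1>h_1+\tilde c_2+h_2$. Then there exists a stepsize $\tilde\Delta_0\in(0,1)$ such that for any $\Delta\in(0,\tilde\Delta_0)$ the backward Euler-Maruyama numerical solution $Z^{j,N}_{t_k}$ is almost surely exponentially stable, i.e., almost surely $$\limsup_{k\to\infty}\frac{1}{k\Delta}\log\Big(\frac1N\sum_{i=1}^N|Z^{i,N}_{t_k}|^2\Big)\leq-\beta^*_\Delta,$$ with a constant $\beta^*_\Delta$ (depending on $\Delta$) fulfilling $\lim_{\Delta\to0}\beta^*_\Delta=\tilde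 c_1-h_1-\tilde c_2-h_2$.
   Context: $(\Omega,\mathcal{F},(\mathcal{F}_t)_{t\ge0},\mathbb{P})$ is a complete filtered probability space satisfying the usual conditions. $|\cdot|$ is the Euclidean norm on $\mathbb{R}^d$ and $\|\cdot\|$ is the Frobenius norm on $\mathbb{R}^{d\times m}$. $\mathcal{P}_2(\mathbb{R}^d)$ is the set of probability measures on $\mathbb{R}^d$ with finite second moment, $\mathbb{W}_2$ is the 2-Wasserstein distance on it, and $\mathcal{W}_2(\mu)=\left(\int_{\mathbb{R}^d}|x|^2\mu(dx)\right)^{1/2}$. The coefficients $b:\mathbb{R}^d\times\mathcal{P}_2(\mathbb{R}^d)\to\mathbb{R}^d$ and $\sigma:\mathbb{R}^d\times\mathcal{P}_2(\mathbb{R}^d)\to\mathbb{R}^{d\times m}$ are Borel measurable and locally Lipschitz with respect to $x$. $X_0$ is a non-zero $\mathcal{F}_0$-measurable $\mathbb{R}^d$-valued random variable with $\mathbb{E}|X_0|^{p}<\infty$ for all $p\ge2$, and $W$ is an $m$-dimensional $(\mathcal{F}_t)$-Brownian motion. Let $N\geq 1$ be an integer, $\mathbb{S}_N=\{1,\dots,N\}$, and for $j\in\mathbb{S}_N$ let $(W^j,X_0^j)$ be independent copies of $(W,X_0)$. Stepsizes are of the form $\Delta=1/M$ with $M$ a positive integer, and $t_k=k\Delta$, $k=0,1,2,\dots$. The backward Euler-Maruyama scheme for the interacting particle system is the implicit scheme $$Z^{j,N}_{t_{k+1}}=Z^{j,N}_{t_k}+b(Z^{j,N}_{t_{k+1}},\mu^{Z,N}_{t_k})\Delta+\sigma(Z^{j,N}_{t_k},\mu^{Z,N}_{t_k})\Delta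 W^j_{t_k},\qquad Z^{j,N}_0=X^j_0,\quad j\in\mathbb{S}_N,$$ where $\Delta W^j_{t_k}=W^j_{t_{k+1}}-W^j_{t_k}$ and $\mu^{Z,N}_{t_k}=\frac1N\sum_{i=1}^N\delta_{Z^{i,N}_{t_k}}$. Convention: $\log 0=-\infty$. *)

(* Defs.v *)
From HB Require Import structures.
From mathcomp Require Import all_boot all_order all_algebra.
From mathcomp Require Import all_classical all_reals all_analysis.
From mathcomp Require Import measurable_realfun.

Set Implicit Arguments.
Unset Strict Implicit.
Unset Printing Implicit Defensive.

Import Order.TTheory GRing.Theory Num.Theory.
Import numFieldNormedType.Exports.

Local Open Scope classical_set_scope.
Local Open Scope ring_scope.

(* R^d is 'cV[R]_d and R^(d x m) is 'M[R]_(d, m). The norm `|A| of the library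
   on matrices is the maximum norm; [frob] is the Frobenius norm, which on
   column vectors is the Euclidean norm. Both norms induce the same topology. *)
Definition frob (R : realType) (p q : nat) (A : 'M[R]_(p, q)) : R :=
  Num.sqrt (\sum_(i < p) \sum_(j < q) A i j ^+ 2).

Definition dot (R : realType) (d : nat) (x y : 'cV[R]_d) : R :=
  \sum_(i < d) x i 0 * y i 0.

(* Matrix spaces carry their Borel sigma-algebra. *)
Definition matrix_opens (R : realType) (p q : nat) : set (set 'M[R]_(p, q)) :=
  [set U | open U].

HB.instance Definition _ (R : realType) (p q : nat) :=
  @isMeasurable.Build (sigma_display (@matrix_opens R p q)) 'M[R]_(p, q)
    <<s @matrix_opens R p q >>
    (@sigma_algebra0 _ setT (@matrix_opens R p q))
    (@sigma_algebraC _ (@matrix_opens R p q))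
    (@sigma_algebra_bigcup _ setT (@matrix_opens R p q)).

Lemma measurable_coord (R : realType) (p q : nat) (i : 'I_p) (j : 'I_q) :
  measurable_fun setT (fun A : 'M[R]_(p, q) => A i j).
Proof.
apply: (measurability _ (RGenOInfty.measurableE R)) => //= _ [_ [x ->] <-].
rewrite setTI; apply: sub_sigma_algebra => /=.
apply: open_comp; last exact: interval_open.
by move=> A _; exact: coord_continuous.
Qed.

Lemma measurable_sqr_frob (R : realType) (p q : nat) :
  measurable_fun setT (fun A : 'M[R]_(p, q) => frob A ^+ 2).
Proof.
have -> : (fun A : 'M[R]_(p, q) => frob A ^+ 2) =
          fun A => \sum_i \sum_j A i j ^+ 2.
  apply/funext => A; rewrite sqr_sqrtr//.
  by do 2!(apply: sumr_ge0 => ? _); exact: sqr_ge0.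
do 2!(apply: measurable_sum => ?).
by apply: measurable_funX; exact: measurable_coord.
Qed.

Section p2.
Local Open Scope ereal_scope.
Context (R : realType) (d : nat).

Record P2 := MkP2 {
  P2_law :> probability 'cV[R]_d R ;
  P2_moment2 : \int[P2_law]_x (frob x ^+ 2)%:E < +oo }.

HB.instance Definition _ := gen_eqMixin P2.
HB.instance Definition _ := gen_choiceMixin P2.

(* The curly W_2(mu), i.e. the W2 distance from mu to the Dirac mass at 0. *)
Definition second_moment_norm (mu : P2) : R :=
  Num.sqrt (fine (\int[mu]_x (frob x ^+ 2)%:E)).

Definition couplings (mu nu : P2) :
    set (probability ('cV[R]_d * 'cV[R]_d)%type R) :=
  [set pi | (forall A, measurable A -> pi (A `*` setT) = mu A) /\
            (forall A, measurable A -> pi (setT `*` A) = nu A)].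

(* The infimum is finite: the product coupling has finite cost. *)
Definition W2 (mu nu : P2) : R :=
  Num.sqrt (fine (ereal_inf
    [set \int[pi]_z (frob (z.1 - z.2)%R ^+ 2)%:E | pi in couplings mu nu])).

End p2.

Section empirical.
Local Open Scope ereal_scope.
Context (R : realType) (d n : nat) (z : 'I_n.+1 -> 'cV[R]_d).

Definition empirical_law : set 'cV[R]_d -> \bar R :=
  mscale (n.+1%:R^-1)%:nng%R (msum (fun k => \d_(z (inord k))) n.+1).

HB.instance Definition _ := Measure.on empirical_law.

Lemma empirical_lawE (A : set 'cV[R]_d) :
  empirical_law A = (n.+1%:R^-1)%R%:E * \sum_(i < n.+1) \d_(z i) A.
Proof.
by congr (_ * _); apply: eq_bigr => i _; rewrite /= inord_val.
Qed.

Let empirical_lawT : empirical_law setT = 1.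
Proof.
rewrite empirical_lawE; under eq_bigr do rewrite diracT.
by rewrite sumEFin -EFinM sumr_const card_ord mulVf.
Qed.

HB.instance Definition _ :=
  Measure_isProbability.Build _ _ _ empirical_law empirical_lawT.

Let empirical_moment2 : \int[empirical_law]_x (frob x ^+ 2)%:E < +oo.
Proof.
have mf : measurable_fun setT (fun x : 'cV[R]_d => (frob x ^+ 2)%:E).
  by apply/measurable_EFinP; exact: measurable_sqr_frob.
have f0 (x : 'cV[R]_d) : 0 <= (frob x ^+ 2)%:E by rewrite lee_fin sqr_ge0.
rewrite [ltLHS](ge0_integral_mscale _ measurableT _ mf)//.
rewrite ge0_integral_measure_sum//.
rewrite lte_mul_pinfty// lte_sum_pinfty// => i _.
by rewrite integral_dirac// diracT mul1e ltry.
Qed.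

Definition empirical : P2 R d := MkP2 empirical_moment2.

End empirical.

(* P2 carries the Borel sigma-algebra of the distance W2. *)
Definition W2_opens (R : realType) (d : nat) : set (set (P2 R d)) :=
  [set U | forall mu, U mu ->
    exists2 e : R, 0 < e & forall nu, W2 mu nu < e -> U nu].

HB.instance Definition _ (R : realType) (d : nat) :=
  isPointed.Build (P2 R d) (empirical (fun _ : 'I_1 => 0)).

HB.instance Definition _ (R : realType) (d : nat) :=
  @isMeasurable.Build (sigma_display (@W2_opens R d)) (P2 R d)
    <<s @W2_opens R d >>
    (@sigma_algebra0 _ setT (@W2_opens R d))
    (@sigma_algebraC _ (@W2_opens R d))
    (@sigma_algebra_bigcup _ setT (@W2_opens R d)).

Section stochastic_basis.
Local Open Scope ereal_scope.
Context (R : realType) (disp : measure_display) (Omega : measurableType disp).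
Context (P : probability Omega R).

(* F t is the sigma-algebra of the filtration at time t, as a set of events.
   Only the times t >= 0 are meaningful, for filtrations and for processes. *)
Definition usual_conditions (F : R -> set (set Omega)) : Prop :=
  [/\ measure_is_complete P,
      forall t : R, (0 <= t)%R ->
        sigma_algebra setT (F t) /\ F t `<=` (measurable : set (set Omega)),
      forall s t : R, (0 <= s)%R -> (s <= t)%R -> F s `<=` F t,
      forall t : R, (0 <= t)%R -> \bigcap_(s in [set s | (t < s)%R]) F s `<=` F t
    & P.-negligible `<=` F 0%R].

Definition measurable_wrt (G : set (set Omega)) (d : nat)
    (X : Omega -> 'cV[R]_d) : Prop :=
  forall B, measurable B -> G (X @^-1` B).

Definition continuous_paths (m : nat) (W : R -> Omega -> 'cV[R]_m) : Prop :=
  {ae P, forall omega, {within `[0%R, +oo[, continuous (W ^~ omega)}}.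

Definition brownian_motion (F : R -> set (set Omega)) (m : nat)
    (W : R -> Omega -> 'cV[R]_m) : Prop :=
  [/\ forall t : R, (0 <= t)%R -> measurable_wrt (F t) (W t),
      {ae P, forall omega, W 0%R omega = 0%R},
      forall s t : R, (0 <= s)%R -> (s < t)%R ->
        forall (A : set Omega) (B : set 'cV[R]_m), F s A -> measurable B ->
          P (A `&` (fun omega => W t omega - W s omega)%R @^-1` B) =
          P A * P ((fun omega => W t omega - W s omega)%R @^-1` B),
      forall s t : R, (0 <= s)%R -> (s < t)%R ->
        forall B : 'I_m -> set R, (forall i, measurable (B i)) ->
          P [set omega | forall i, B i ((W t omega - W s omega)%R i 0%R)] =
          \prod_(i < m) normal_prob 0 (Num.sqrt (t - s)) (B i)
    & continuous_paths W].

Section copies.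
Context (d m n : nat).

(* The canonical space of (W, X_0): paths on [0, +oo[ together with an initial
   value, with the sigma-algebra generated by the coordinates. *)
Definition path_events : set (set ((R -> 'cV[R]_m) * 'cV[R]_d)) :=
  <<s [set E | (exists t, (0 <= t)%R /\ exists2 B, measurable B &
                  E = [set w | B (w.1 t)])
             \/ (exists2 B, measurable B & E = [set w | B w.2])] >>.

Definition path_preimage (W : R -> Omega -> 'cV[R]_m)
    (X0 : Omega -> 'cV[R]_d) (E : set ((R -> 'cV[R]_m) * 'cV[R]_d)) :
    set Omega :=
  [set omega | E (W ^~ omega, X0 omega)].

Definition independent_copies
    (W : R -> Omega -> 'cV[R]_m) (X0 : Omega -> 'cV[R]_d)
    (Wc : 'I_n -> R -> Omega -> 'cV[R]_m)
    (X0c : 'I_n -> Omega -> 'cV[R]_d) : Prop :=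
  [/\ forall j E, path_events E ->
        measurable (path_preimage (Wc j) (X0c j) E) /\
        P (path_preimage (Wc j) (X0c j) E) = P (path_preimage W X0 E),
      forall E : 'I_n -> set ((R -> 'cV[R]_m) * 'cV[R]_d),
        (forall j, path_events (E j)) ->
        P (\bigcap_(j in setT) path_preimage (Wc j) (X0c j) (E j)) =
        \prod_(j < n) P (path_preimage (Wc j) (X0c j) (E j))
    & forall j, continuous_paths (Wc j)].

End copies.

(* Z k j is the j-th particle at time k * Delta. The scheme is implicit, so it is
   stated as an equation on Z; it holds almost surely. *)
Definition backward_EM (d m n : nat)
    (b : 'cV[R]_d -> P2 R d -> 'cV[R]_d)
    (sigma : 'cV[R]_d -> P2 R d -> 'M[R]_(d, m))
    (W : 'I_n.+1 -> R -> Omega -> 'cV[R]_m)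
    (X0 : 'I_n.+1 -> Omega -> 'cV[R]_d)
    (Delta : R) (Z : nat -> 'I_n.+1 -> Omega -> 'cV[R]_d) : Prop :=
  [/\ forall k j, measurable_fun setT (Z k j),
      forall j, {ae P, forall omega, Z 0%N j omega = X0 j omega}
    & forall k j, {ae P, forall omega,
        let mu := empirical (fun i => Z k i omega) in
        let dW := (W j (k.+1%:R * Delta) omega - W j (k%:R * Delta) omega)%R in
        Z k.+1 j omega =
          (Z k j omega + Delta *: b (Z k.+1 j omega) mu
           + sigma (Z k j omega) mu *m dW)%R}].

End stochastic_basis.

Definition locally_lipschitz (R : realType) (d p q : nat)
    (f : 'cV[R]_d -> 'M[R]_(p, q)) : Prop :=
  forall r : R, exists L : R, forall x y : 'cV[R]_d,
    frob x <= r -> frob y <= r -> frob (f x - f y) <= L * frob (x - y).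

(* Main.v *)
(* Let S_k be the mean square of the particles at step k, D the stepsize and
   a = c2 + h1 + h2. Taking squared norms in
   Z_{k+1} - D b(Z_{k+1}, mu_k) = Z_k + sigma(Z_k, mu_k) dW_k, the drift condition
   bounds (1 + c1 D) S_{k+1}, and in expectation the cross term vanishes and the
   noise term is at most D (h1 + h2) E S_k; hence E S_{k+1} <= q E S_k with
   q = (1 + a D) / (1 + c1 D). By Markov and Borel-Cantelli, almost surely
   S_k <= r^k eventually, for each r > q, so the rate is -ln q / D, which tends to
   c1 - a as D -> 0.

   The expectations need dW_k independent of Z_k. The monotonicity condition
   makes Z_{k+1} depend continuously on Z_k and Z_k + sigma(Z_k, mu_k) dW_k
   wherever the implicit equation holds, so by induction Z_k is measurable for
   the completed sigma-algebra of the initial values and the Brownian paths until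
   time k D, whether or not the equation is solvable for all data. *)
From HB Require Import structures.
Require Import Defs.
From mathcomp Require Import all_boot all_order all_algebra.
From mathcomp Require Import all_classical all_reals all_analysis.
From mathcomp Require Import measurable_realfun.
From mathcomp Require Import ring lra.

Set Implicit Arguments.
Unset Strict Implicit.

Import Order.TTheory GRing.Theory Num.Theory.
Import numFieldNormedType.Exports.

Local Open Scope classical_set_scope.
Local Open Scope ring_scope.

(** The filtration [F] is tied to the pair (W, X_0) only, while the particles are driven by copies
    that need not be adapted to it. So the past of the particle system is rebuilt from path events:
    inside one copy an increment is independent of the past because this holds for (W, X_0), and
    across copies by their mutual independence. As the empirical measure couples the particles, this
    past has to contain all copies.

    The dimension m in the diffusion condition pays for a Cauchy-Schwarz bound of |sigma dW|^2 by
    squares of single entries. After it, only single coordinates of the increments enter, through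
    their mean, an upper bound of their second moment, and their independence from the past.
    Integrability of S_{k+1} is not given; it comes from the same one-step inequality by
    domination. *)

(** * Euclidean and Frobenius norms *)

Lemma sqr_frob (R : realType) (p q : nat) (A : 'M[R]_(p, q)) :
  frob A ^+ 2 = \sum_i \sum_j A i j ^+ 2.
Proof.
by rewrite sqr_sqrtr//; do 2!(apply: sumr_ge0 => ? _); exact: sqr_ge0.
Qed.

Lemma sqr_frob_col (R : realType) (d : nat) (x : 'cV[R]_d) :
  frob x ^+ 2 = \sum_i x i 0 ^+ 2.
Proof. by rewrite sqr_frob; apply: eq_bigr => i _; rewrite big_ord1. Qed.

Lemma frob_ge0 (R : realType) (p q : nat) (A : 'M[R]_(p, q)) : 0 <= frob A.
Proof. exact: sqrtr_ge0. Qed.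

Lemma ler_sqr_frob (R : realType) (p q : nat) (A : 'M[R]_(p, q)) i j :
  A i j ^+ 2 <= frob A ^+ 2.
Proof.
rewrite sqr_frob (bigD1 i)//= (bigD1 j)//= -addrA lerDl.
by rewrite addr_ge0 ?sumr_ge0// => *; rewrite ?sumr_ge0// => *; exact: sqr_ge0.
Qed.

Lemma sqr_frobD_le (R : realType) (p q : nat) (A B : 'M[R]_(p, q)) :
  frob (A + B) ^+ 2 <= 2 * (frob A ^+ 2 + frob B ^+ 2).
Proof.
rewrite !sqr_frob -big_split mulr_sumr; apply: ler_sum => i _ /=.
rewrite -big_split mulr_sumr; apply: ler_sum => j _ /=; rewrite mxE.
by rewrite -subr_ge0 (_ : _ - _ = (A i j - B i j) ^+ 2) ?sqr_ge0//; ring.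
Qed.

Lemma sqr_frobD (R : realType) (d : nat) (x y : 'cV[R]_d) :
  frob (x + y) ^+ 2 = frob x ^+ 2 + 2 * dot x y + frob y ^+ 2.
Proof.
rewrite !sqr_frob_col mulr_sumr -!big_split; apply: eq_bigr => i _ /=.
by rewrite mxE; ring.
Qed.

Lemma dot_le (R : realType) (d : nat) (x y : 'cV[R]_d) :
  2 * dot x y <= frob x ^+ 2 + frob y ^+ 2.
Proof.
rewrite !sqr_frob_col mulr_sumr -!big_split; apply: ler_sum => i _ /=.
by rewrite -subr_ge0 (_ : _ - _ = (x i 0 - y i 0) ^+ 2) ?sqr_ge0//; ring.
Qed.

Lemma dotZr (R : realType) (d : nat) (a : R) (x y : 'cV[R]_d) :
  dot x (a *: y) = a * dot x y.
Proof.
by rewrite mulr_sumr; apply: eq_bigr => i _; rewrite mxE mulrCA.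
Qed.

Lemma dotBr (R : realType) (d : nat) (x y z : 'cV[R]_d) :
  dot x (y - z) = dot x y - dot x z.
Proof. by rewrite -sumrB; apply: eq_bigr => i _; rewrite !mxE mulrBr. Qed.

Lemma dotxx (R : realType) (d : nat) (x : 'cV[R]_d) : dot x x = frob x ^+ 2.
Proof. by rewrite sqr_frob_col; apply: eq_bigr => i _; rewrite expr2. Qed.

(** Cauchy-Schwarz from Lagrange's identity: the right side minus the left is half the sum of (a_j -
    a_k)^2 over all j, k. *)
Lemma sqr_sum_le (R : realType) (m : nat) (a : 'I_m -> R) :
  (\sum_j a j) ^+ 2 <= m%:R * \sum_j a j ^+ 2.
Proof.
have -> : m%:R * (\sum_j a j ^+ 2) =
    \sum_j \sum_k 2^-1 * (a j ^+ 2 + a k ^+ 2).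
  under [RHS]eq_bigr do rewrite -mulr_sumr big_split/= sumr_const card_ord.
  rewrite -mulr_sumr big_split/= sumr_const card_ord sumrMnl -mulr_natl.
  by field.
rewrite expr2 mulr_suml; apply: ler_sum => j _.
rewrite mulr_sumr; apply: ler_sum => k _.
rewrite -subr_ge0 (_ : _ - _ = 2^-1 * (a j - a k) ^+ 2); last by field.
by rewrite mulr_ge0 ?sqr_ge0 ?invr_ge0.
Qed.

(** The factor m is the price for a bound without mixed products w_j w_k, so that its expectation
    involves one coordinate of the noise at a time. *)
Lemma sqr_frob_mulmx_le (R : realType) (d m : nat) (A : 'M[R]_(d, m))
    (w : 'cV[R]_m) :
  frob (A *m w) ^+ 2 <= m%:R * \sum_i \sum_j A i j ^+ 2 * w j 0 ^+ 2.
Proof.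
rewrite sqr_frob_col mulr_sumr; apply: ler_sum => i _; rewrite mxE.
by under [X in _ * X]eq_bigr do rewrite -exprMn; exact: sqr_sum_le.
Qed.

(** * Empirical measures: second moments and Wasserstein distance *)

Section empirical_moments.
Context (R : realType) (d n : nat).

Lemma sqr_second_moment_norm_empirical (z : 'I_n.+1 -> 'cV[R]_d) :
  second_moment_norm (empirical z) ^+ 2 =
  n.+1%:R^-1 * \sum_i frob (z i) ^+ 2.
Proof.
have mf : measurable_fun setT (fun x : 'cV[R]_d => (frob x ^+ 2)%:E).
  by apply/measurable_EFinP; exact: measurable_sqr_frob.
have f0 (x : 'cV[R]_d) : (0 <= (frob x ^+ 2)%:E)%E by rewrite lee_fin sqr_ge0.
have s0 : 0 <= n.+1%:R^-1 * \sum_i frob (z i) ^+ 2.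
  by rewrite mulr_ge0 ?invr_ge0// sumr_ge0// => i _; exact: sqr_ge0.
rewrite /second_moment_norm -[RHS]sqr_sqrtr//; congr (Num.sqrt _ ^+ 2).
rewrite [X in fine X](ge0_integral_mscale _ measurableT _ mf)//.
rewrite ge0_integral_measure_sum//.
under eq_bigr do rewrite integral_dirac// diracT mul1e.
by rewrite sumEFin -EFinM; under eq_bigr do rewrite inord_val.
Qed.

End empirical_moments.

Section empirical_coupling.
Local Open Scope ereal_scope.
Context (R : realType) (d n : nat) (z w : 'I_n.+1 -> 'cV[R]_d).

(** The coupling that matches the i-th atoms. It is not optimal in general, but any coupling bounds
    W2 from above. *)
Let pairs : set ('cV[R]_d * 'cV[R]_d)%type -> \bar R :=
  mscale (n.+1%:R^-1)%:nng%R (msum (fun k => \d_(z (inord k), w (inord k))) n.+1).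

HB.instance Definition _ := Measure.on pairs.

Let pairsE (A : set ('cV[R]_d * 'cV[R]_d)%type) :
  pairs A = (n.+1%:R^-1)%R%:E * \sum_(i < n.+1) \d_(z i, w i) A.
Proof.
by congr (_ * _); apply: eq_bigr => i _; rewrite /= inord_val.
Qed.

Let pairsT : pairs setT = 1.
Proof.
rewrite pairsE; under eq_bigr do rewrite diracT.
by rewrite sumEFin -EFinM sumr_const card_ord mulVf.
Qed.

HB.instance Definition _ :=
  Measure_isProbability.Build _ _ _ pairs pairsT.

Let pairs_coupling : couplings (empirical z) (empirical w) pairs.
Proof.
split => A mA; rewrite /= pairsE empirical_lawE; congr (_ * _);
  apply: eq_bigr => i _; rewrite !diracE; congr (_%:R%:E); congr nat_of_bool;
  by apply/idP/idP; rewrite !inE/= => // -[].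
Qed.

(** This makes the empirical measure a continuous function of the particle positions. *)
Lemma sqr_W2_empirical_le :
  (W2 (empirical z) (empirical w) ^+ 2 <=
   n.+1%:R^-1 * \sum_i frob (z i - w i) ^+ 2)%R.
Proof.
have mf : measurable_fun setT
    (fun x : 'cV[R]_d * 'cV[R]_d => (frob (x.1 - x.2)%R ^+ 2)%:E).
  apply/measurable_EFinP.
  rewrite (_ : (fun x => _) = (fun x : 'cV[R]_d * 'cV[R]_d =>
    \sum_i (x.1 i 0 - x.2 i 0) ^+ 2)%R); last first.
    by apply/funext => x; rewrite sqr_frob_col; under eq_bigr do rewrite !mxE.
  apply: measurable_sum => i; apply: measurable_funX; apply: measurable_funB.
    by apply: (measurableT_comp (@measurable_coord R d 1 i 0%R)); exact: measurable_fst.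
  by apply: (measurableT_comp (@measurable_coord R d 1 i 0%R)); exact: measurable_snd.
have f0 (x : 'cV[R]_d * 'cV[R]_d) : 0 <= (frob (x.1 - x.2)%R ^+ 2)%:E.
  by rewrite lee_fin sqr_ge0.
set s := (n.+1%:R^-1 * _)%R.
have s0 : (0 <= s)%R.
  by rewrite mulr_ge0 ?invr_ge0// sumr_ge0// => i _; exact: sqr_ge0.
have costE : \int[pairs]_x (frob (x.1 - x.2)%R ^+ 2)%:E = s%:E.
  rewrite [LHS](ge0_integral_mscale _ measurableT _ mf)//.
  rewrite ge0_integral_measure_sum//.
  under eq_bigr do rewrite integral_dirac// diracT mul1e.
  by rewrite sumEFin -EFinM; under eq_bigr do rewrite /= inord_val.
rewrite /W2; set I := ereal_inf _.
(* [W2] goes through [fine], which is monotone only on finite values; hence the infimum is first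
   enclosed between 0 and [s]. *)
have I0 : 0 <= I.
  by apply/ereal_infP => _ [pi _ <-]; exact: integral_ge0.
have Is : I <= s%:E.
  by apply: ereal_inf_lbound; exists pairs => //; exact: pairs_coupling.
rewrite sqr_sqrtr ?fine_ge0//.
by rewrite -[leRHS]/(fine s%:E) fine_le// ge0_fin_numE// (le_lt_trans Is) ?ltry.
Qed.

End empirical_coupling.

(** * Expectation of functions of two independent variables *)

Section independent_pair.
Local Open Scope ereal_scope.
Context d (T : measurableType d) (R : realType) (P : probability T R).

Definition independent_rv (X Y : T -> R) : Prop :=
  forall A B, measurable A -> measurable B ->
    P (X @^-1` A `&` Y @^-1` B) = P (X @^-1` A) * P (Y @^-1` B).

Lemma independent_rv_comp (X Y : T -> R) (f g : R -> R) :
  measurable_fun setT f -> measurable_fun setT g ->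
  independent_rv X Y -> independent_rv (f \o X) (g \o Y).
Proof.
move=> mf mg XY A B mA mB; apply: (XY (f @^-1` A) (g @^-1` B)).
  by rewrite -[X in measurable X]setTI; exact: mf.
by rewrite -[X in measurable X]setTI; exact: mg.
Qed.

Section joint_law.
Variables (X Y : {RV P >-> R}).
Hypothesis XY : independent_rv X Y.

Let mpair : measurable_fun setT (fun t => (X t, Y t)).
Proof. exact: measurable_fun_pair. Qed.

Let joint := distribution P (mfun_Sub (mem_set mpair)).

Lemma independent_joint_law A : measurable A ->
  (distribution P X \x distribution P Y) A = joint A.
Proof.
by apply: product_measure_unique => B C mB mC; exact: XY.
Qed.

Lemma ge0_integral_independent_pair (f : R * R -> \bar R) :
  measurable_fun setT f -> (forall z, 0 <= f z) ->
  \int[P]_t f (X t, Y t) =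
  \int[distribution P X]_x \int[distribution P Y]_y f (x, y).
Proof.
move=> mf f0; rewrite -fubini_tonelli1//.
rewrite (eq_measure_integral joint)//; last first.
  by move=> A mA _; exact: independent_joint_law.
by rewrite ge0_integral_distribution.
Qed.

Lemma integral_independent_pair (f : R * R -> \bar R) :
  measurable_fun setT f -> P.-integrable setT (fun t => f (X t, Y t)) ->
  \int[P]_t f (X t, Y t) =
  \int[distribution P X]_x \int[distribution P Y]_y f (x, y).
Proof.
move=> mf fi; rewrite (integral12_prod_meas1 (f := f)); last first.
  apply/integrableP; split => //.
  rewrite fubini_tonelli1//; last exact: measurableT_comp.
  rewrite -(@ge0_integral_independent_pair (abse \o f))//.
  - by move/integrableP: fi => [].
  - exact: measurableT_comp.
  - by move=> z; exact: abse_ge0.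
rewrite (eq_measure_integral joint)//; last first.
  by move=> A mA _; exact: independent_joint_law.
by rewrite integral_distribution.
Qed.

End joint_law.

Lemma ge0_integral_independentM (X Y : T -> R) :
  measurable_fun setT X -> measurable_fun setT Y -> independent_rv X Y ->
  (forall t, 0 <= X t)%R -> (forall t, 0 <= Y t)%R ->
  \int[P]_t (X t * Y t)%:E = \int[P]_t (X t)%:E * \int[P]_t (Y t)%:E.
Proof.
move=> mX mY XY X0 Y0.
pose X' : {RV P >-> R} := mfun_Sub (mem_set mX).
pose Y' : {RV P >-> R} := mfun_Sub (mem_set mY).
have mn : measurable_fun setT (fun x : R => `|x|%:E).
  by apply/measurable_EFinP; exact: normr_measurable.
(* Tonelli needs an integrand that is nonnegative on the whole plane, not only on the range of (X,
   Y). *)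
transitivity (\int[P]_t (`|X t| * `|Y t|)%:E).
  by apply: eq_integral => t _; rewrite !ger0_norm.
rewrite (@ge0_integral_independent_pair X' Y' XY
  (fun z => (`|z.1| * `|z.2|)%:E)); last 2 first.
- apply/measurable_EFinP/measurable_funM.
  + by apply: (measurableT_comp (@normr_measurable _ _)); exact: measurable_fst.
  + by apply: (measurableT_comp (@normr_measurable _ _)); exact: measurable_snd.
- by move=> z; rewrite lee_fin mulr_ge0.
under eq_integral => x _.
  under eq_integral do rewrite EFinM /=.
  rewrite ge0_integralZl//.
  over.
rewrite ge0_integralZr//; last exact: integral_ge0.
rewrite !ge0_integral_distribution//=.
by congr (_ * _); apply: eq_integral => t _; rewrite ger0_norm.
Qed.

(** Independence passes to |X| and |Y|, so E|XY| = E|X| E|Y| is finite by the nonnegative case; no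
    square integrability is involved. *)
Lemma integrable_independentM (X Y : T -> R) :
  independent_rv X Y ->
  P.-integrable setT (EFin \o X) -> P.-integrable setT (EFin \o Y) ->
  P.-integrable setT (fun t => (X t * Y t)%:E).
Proof.
move=> XY /integrableP[/measurable_EFinP mX iX] /integrableP[/measurable_EFinP mY iY].
apply/integrableP; split; first exact/measurable_EFinP/measurable_funM.
under eq_integral do rewrite /= normrM.
rewrite ge0_integral_independentM//.
- by rewrite lte_mul_pinfty ?integral_ge0// ge0_fin_numE ?integral_ge0.
- exact: measurableT_comp.
- exact: measurableT_comp.
- by apply: independent_rv_comp.
Qed.

Lemma integral_independentM (X Y : T -> R) :
  independent_rv X Y ->
  P.-integrable setT (EFin \o X) -> P.-integrable setT (EFin \o Y) ->
  \int[P]_t (X t * Y t)%:E = \int[P]_t (X t)%:E * \int[P]_t (Y t)%:E.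
Proof.
move=> XY iX iY.
have /integrableP[/measurable_EFinP mX _] := iX.
have /integrableP[/measurable_EFinP mY _] := iY.
pose X' : {RV P >-> R} := mfun_Sub (mem_set mX).
pose Y' : {RV P >-> R} := mfun_Sub (mem_set mY).
rewrite (@integral_independent_pair X' Y' XY (fun z => (z.1 * z.2)%:E)); last 2 first.
- exact/measurable_EFinP/measurable_funM.
- exact: integrable_independentM.
have iX' : (distribution P X').-integrable setT EFin.
  exact: integrable_pushforward.
have iY' : (distribution P Y').-integrable setT EFin.
  exact: integrable_pushforward.
under eq_integral => x _.
  under eq_integral do rewrite EFinM /=.
  rewrite integralZl//.
  over.
have fY : \int[distribution P Y']_y y%:E \is a fin_num.
  exact: integrable_fin_num.
rewrite -(fineK fY) integralZr// (fineK fY).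
by congr (_ * _); rewrite integral_distribution.
Qed.

End independent_pair.

(** * First and second moments of the centred normal law *)

Section normal_moments.
Local Open Scope ereal_scope.
Context (R : realType).
Notation leb := (@lebesgue_measure R).

(** The density and the Radon-Nikodym derivative have equal integrals over every measurable set,
    hence agree almost everywhere; the rest is change of variables. *)
Lemma ge0_integral_normal_prob (m s : R) (g : R -> \bar R) :
  measurable_fun setT g -> (forall x, 0 <= g x) ->
  \int[normal_prob m s]_x g x =
  \int[leb]_x (g x * (normal_pdf m s x)%:E).
Proof.
move=> mg g0.
have dom : normal_prob m s `<< leb := normal_prob_dominates m s.
rewrite -(Radon_Nikodym_SigmaFinite.change_of_variables dom)//.
set f := Radon_Nikodym_SigmaFinite.f _ _.
have mf : measurable_fun setT f.
  exact: measurable_int (Radon_Nikodym_SigmaFinite.f_integrable dom).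
have mp : measurable_fun setT (fun x => (normal_pdf m s x)%:E).
  by apply/measurable_EFinP; exact: measurable_normal_pdf.
have fp : ae_eq leb setT f (fun x => (normal_pdf m s x)%:E).
  apply: integral_ae_eq => //.
    exact: Radon_Nikodym_SigmaFinite.f_integrable.
  move=> E _ mE; rewrite -Radon_Nikodym_SigmaFinite.f_integral//.
apply: ae_eq_integral => //; try exact: emeasurable_funM.
by apply: filterS fp => x fx /fx ->.
Qed.

(* This is 1 + y <= exp y with y = (1/(2s^2) - 1/(2t^2)) x^2; integrating it and
   letting t decrease to s bounds the second moment of the normal law by s^2. *)
Lemma normal_pdf_sqr_le (s t x : R) : (0 < s < t)%R ->
  (normal_pdf 0 s x * (1 + ((2 * s ^+ 2)^-1 - (2 * t ^+ 2)^-1) * x ^+ 2) <=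
   t / s * normal_pdf 0 t x)%R.
Proof.
move=> /andP[s0 st]; have t0 : (0 < t)%R := lt_trans s0 st.
have peakE (u : R) : (0 < u)%R -> normal_peak u = (u^-1 * normal_peak 1)%R.
  move=> u0; rewrite /normal_peak -invfM expr1n mul1r -mulrnAr.
  by rewrite sqrtrM ?sqr_ge0// sqrtr_sqr gtr0_norm// mulrC.
rewrite !normal_pdfE ?gt_eqF// (peakE s)// (peakE t)// /normal_fun subr0.
rewrite [leLHS](_ : _ = s^-1 * normal_peak 1 *
    (expR (- x ^+ 2 / (s ^+ 2 *+ 2)) *
     (1 + ((2 * s ^+ 2)^-1 - (2 * t ^+ 2)^-1) * x ^+ 2)))%R; last by rewrite !mulrA.
rewrite [leRHS](_ : _ = s^-1 * normal_peak 1 *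
    expR (- x ^+ 2 / (t ^+ 2 *+ 2)))%R; last first.
  by field; rewrite !gt_eqF.
apply: ler_wpM2l.
  by apply: mulr_ge0; [rewrite invr_ge0 ltW | exact: normal_peak_ge0].
rewrite [in leRHS](_ : - x ^+ 2 / _ = - x ^+ 2 / (s ^+ 2 *+ 2) +
    ((2 * s ^+ 2)^-1 - (2 * t ^+ 2)^-1) * x ^+ 2)%R; last first.
  by field; rewrite !gt_eqF.
by rewrite expRD ler_wpM2l ?expR_ge0// expR_ge1Dx.
Qed.

Lemma integral_sqr_normal_le (s : R) : (0 < s)%R ->
  \int[normal_prob 0 s]_x (x ^+ 2)%:E <= (s ^+ 2)%:E.
Proof.
move=> s0.
have msqr : measurable_fun setT (fun x : R => (x ^+ 2)%:E).
  by apply/measurable_EFinP; exact: measurable_funX.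
rewrite ge0_integral_normal_prob//; last by move=> x; rewrite lee_fin sqr_ge0.
set V := integral _ _ _.
have V0 : 0 <= V.
  by apply: integral_ge0 => x _; rewrite mule_ge0// lee_fin ?sqr_ge0// normal_pdf_ge0.
have mpdf u : measurable_fun setT (fun x => (normal_pdf 0 u x)%:E : \bar R).
  by apply/measurable_EFinP; exact: measurable_normal_pdf.
have bound t : (s < t)%R ->
    1 + ((2 * s ^+ 2)^-1 - (2 * t ^+ 2)^-1)%:E * V <= (t / s)%:E.
  move=> st; have t0 : (0 < t)%R := lt_trans s0 st.
  set c := ((2 * s ^+ 2)^-1 - (2 * t ^+ 2)^-1)%R.
  have c0 : (0 <= c)%R.
    rewrite subr_ge0 lef_pV2 ?posrE ?mulr_gt0 ?exprn_gt0//.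
    by rewrite ler_pM2l// ler_sqr ?nnegrE ltW.
  rewrite -[X in X + _](integral_normal_pdf 0 s) -ge0_integralZl//; last 2 first.
    by apply: emeasurable_funM => //; exact: mpdf.
    by move=> x _; rewrite mule_ge0// lee_fin ?sqr_ge0// normal_pdf_ge0.
  rewrite -ge0_integralD//; last 4 first.
    by move=> x _; rewrite lee_fin normal_pdf_ge0.
    exact: mpdf.
    by move=> x _; rewrite !mule_ge0// lee_fin ?sqr_ge0// normal_pdf_ge0.
    by do 2 apply: emeasurable_funM => //; exact: mpdf.
  rewrite -[leRHS]mule1 -(integral_normal_pdf 0 t) -ge0_integralZl//; last 3 first.
    exact: mpdf.
    by move=> x _; rewrite lee_fin normal_pdf_ge0.
    by rewrite lee_fin divr_ge0 ?ltW.
  apply: ge0_le_integral => //.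
  - move=> x _; rewrite adde_ge0 ?mule_ge0// lee_fin ?sqr_ge0//;
    exact: normal_pdf_ge0.
  - apply: emeasurable_funD; first exact: mpdf.
    by do 2 apply: emeasurable_funM => //; exact: mpdf.
  - by apply: emeasurable_funM => //; exact: mpdf.
  - move=> x _; rewrite -!EFinM -EFinD lee_fin.
    apply: le_trans (normal_pdf_sqr_le x _); last by rewrite s0.
    by rewrite le_eqVlt; apply/orP; left; apply/eqP; rewrite /c; ring.
(* Already t = 2s rules out V = +oo, since the coefficient of V is positive there and the right side
   is finite. *)
have Vfin : V \is a fin_num.
  rewrite ge0_fin_numE//; have := bound (s *+ 2)%R.
  rewrite mulr2n ltrDl => /(_ s0); rewrite ltey; apply: contraTneq => ->.
  rewrite gt0_muley; last first.
    rewrite lte_fin subr_gt0 ltf_pV2 ?posrE ?mulr_gt0 ?exprn_gt0 ?addr_gt0//.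
    by rewrite ltr_pM2l// ltr_sqr ?nnegrE ?ltrDl ?addr_ge0 ?ltW.
  by rewrite addey.
rewrite -(fineK Vfin) lee_fin; set v := fine V.
have v0 : (0 <= v)%R by exact: fine_ge0.
(* For t = s (1 + e) the bound reduces to (2 + e) v <= 2 s^2 (1 + e)^2 after division by e; then e^2
   <= e gives the factor 1 + 3 e. *)
have {}bound e : (0 < e < 1)%R -> (v <= s ^+ 2 * (1 + 3 * e))%R.
  move=> /andP[e0 e1].
  have := bound (s * (1 + e))%R; rewrite ltr_pMr// ltrDl => /(_ e0).
  rewrite -(fineK Vfin) -EFinM -EFinD lee_fin -/v => H.
  have s2 : (0 < s ^+ 2)%R by exact: exprn_gt0.
  have {}H : (e * (2 + e) * v <= e * (2 * s ^+ 2 * (1 + e) ^+ 2))%R.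
    have E1 : (2 * s ^+ 2 * (1 + e) ^+ 2 * (1 + ((2 * s ^+ 2)^-1 -
       (2 * (s * (1 + e)) ^+ 2)^-1) * v) =
       2 * s ^+ 2 * (1 + e) ^+ 2 + e * (2 + e) * v)%R.
      by field; rewrite !gt_eqF// addr_gt0.
    have E2 : (2 * s ^+ 2 * (1 + e) ^+ 2 * (s * (1 + e) / s) =
       2 * s ^+ 2 * (1 + e) ^+ 2 + e * (2 * s ^+ 2 * (1 + e) ^+ 2))%R.
      by field; rewrite gt_eqF.
    rewrite -(lerD2l (2 * s ^+ 2 * (1 + e) ^+ 2)%R) -E1 -E2 ler_wpM2l//.
    by do 2 (apply: mulr_ge0; rewrite ?sqr_ge0//).
  have {}H : ((2 + e) * v <= 2 * s ^+ 2 * (1 + e) ^+ 2)%R.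
    by rewrite -(ler_pM2l e0) mulrA.
  have : (2 * v <= 2 * (s ^+ 2 * (1 + 3 * e)))%R.
    apply: (@le_trans _ _ ((2 + e) * v)%R); first by nra.
    apply: (le_trans H); nra.
  by rewrite ler_pM2l.
rewrite leNgt; apply/negP => vs.
pose del := (v - s ^+ 2)%R.
have del0 : (0 < del)%R by rewrite subr_gt0.
have s2 : (0 < s ^+ 2)%R by exact: exprn_gt0.
(* For this e the excess 3 s^2 e equals del times 3 s^2 / (del + 3 s^2), which is less than del: a
   contradiction. *)
have := bound (del / (del + 3 * s ^+ 2))%R.
have D0 : (0 < del + 3 * s ^+ 2)%R by rewrite addr_gt0// mulr_gt0.
rewrite divr_gt0//= ltr_pdivrMr// mul1r ltrDl mulr_gt0// => /(_ isT).
apply/negP; rewrite -ltNge -(ltr_pM2r D0).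
rewrite -[X in (X < _)%R]mulrA.
have -> : ((1 + 3 * (del / (del + 3 * s ^+ 2))) * (del + 3 * s ^+ 2) =
  del + 3 * s ^+ 2 + 3 * del)%R by field; rewrite gt_eqF.
have -> : v = (s ^+ 2 + del)%R by rewrite /del; ring.
nra.
Qed.

(** The density is even, so x -> -x carries the negative part of the integral to the positive part.
    They cancel only because they are finite, which follows from x <= 1 + x^2 and the second moment
    bound. *)
Lemma integral_id_normal (s : R) : (0 < s)%R ->
  \int[normal_prob 0 s]_x x%:E = 0.
Proof.
move=> s0.
have mid : measurable_fun setT (EFin : R -> \bar R) by exact/measurable_EFinP.
have cpdf : continuous (normal_pdf 0 s) by apply: continuous_normal_pdf; rewrite gt_eqF.
rewrite integralE !ge0_integral_normal_prob//; last 2 first.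
- exact: measurable_funeneg.
- exact: measurable_funepos.
rewrite (_ : \int[leb]_x (_^\+ x * _) =
    \int[leb]_(x in `[0%R, +oo[) (x * normal_pdf 0 s x)%:E); last first.
  rewrite [RHS]integral_mkcond; apply: eq_integral => x _.
  rewrite patchE/= mem_setE in_itv/= andbT funeposE; case: ifPn => x0.
    by rewrite max_l ?lee_fin// EFinM.
  by rewrite max_r ?mul0e// lee_fin ltW// ltNge.
(* The endpoint is written [- 0] to have the shape of a reflected half-line in the substitution
   below. *)
rewrite (_ : \int[leb]_x (_^\- x * _) =
    \int[leb]_(x in `]-oo, (- 0)%R]) ((- x) * normal_pdf 0 s x)%:E); last first.
  rewrite [RHS]integral_mkcond; apply: eq_integral => x _.
  rewrite patchE/= mem_setE in_itv/= oppr0 funenegE; case: ifPn => x0.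
    by rewrite max_l -?EFinN ?lee_fin ?oppr_ge0// EFinM.
  by rewrite max_r ?mul0e// -EFinN lee_fin oppr_le0 ltW// ltNge.
rewrite ge0_integration_by_substitutionNy//; last 2 first.
- apply: continuous_subspaceT => x; apply: cvgM; last exact: cpdf.
  by apply: cvgN; exact: cvg_id.
- move=> x; rewrite in_itv/= oppr0 => x0.
  by rewrite mulr_ge0 ?normal_pdf_ge0// oppr_ge0 ltW.
rewrite [X in _ - X](_ : _ =
    \int[leb]_(x in `[0%R, +oo[) (x * normal_pdf 0 s x)%:E); last first.
  apply: eq_integral => x _ /=; rewrite opprK !normal_pdfE ?gt_eqF//.
  by rewrite /normal_fun !subr0 sqrrN.
rewrite subee// ge0_fin_numE; last first.
  apply: integral_ge0 => x; rewrite /= in_itv/= andbT => x0.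
  by rewrite lee_fin mulr_ge0// normal_pdf_ge0.
have : \int[normal_prob 0 s]_x (1 + x ^+ 2)%:E < +oo.
  under eq_integral do rewrite EFinD.
  rewrite ge0_integralD//; last 2 first.
    by move=> x _; rewrite lee_fin sqr_ge0.
    by apply/measurable_EFinP; exact: measurable_funX.
  apply: lte_add_pinfty.
    rewrite integral_cst// mul1e.
    by apply: (le_lt_trans (probability_le1 _ measurableT)); rewrite ltry.
  by apply: le_lt_trans (integral_sqr_normal_le s0) _; rewrite ltry.
apply: le_lt_trans.
rewrite ge0_integral_normal_prob//; last 2 first.
- by apply/measurable_EFinP; apply: measurable_funD => //; exact: measurable_funX.
- by move=> x; rewrite lee_fin addr_ge0// sqr_ge0.
have mpdf := measurable_normal_pdf 0 s.
apply: (@le_trans _ _ (\int[leb]_(x in `[0%R, +oo[)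
   ((1 + x ^+ 2)%:E * (normal_pdf 0 s x)%:E))).
  apply: ge0_le_integral => //.
  - move=> x; rewrite /= in_itv/= andbT => x0.
    by rewrite lee_fin mulr_ge0// normal_pdf_ge0.
  - by apply/measurable_EFinP; apply: measurable_funTS; exact: measurable_funM.
  - apply/measurable_EFinP; apply: measurable_funTS; apply: measurable_funM => //.
    by apply: measurable_funD => //; exact: measurable_funX.
  - move=> x _; rewrite -EFinM lee_fin ler_wpM2r ?normal_pdf_ge0//.
    have := sqr_ge0 (x - 1); have := sqr_ge0 x; rewrite sqrrB; nra.
apply: ge0_subset_integral => //.
- apply/measurable_EFinP; apply: measurable_funM => //.
  by apply: measurable_funD => //; exact: measurable_funX.
- move=> x _; rewrite -EFinM lee_fin mulr_ge0 ?normal_pdf_ge0//.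
  by rewrite addr_ge0 ?sqr_ge0.
Qed.

End normal_moments.

(** * Measurability from continuous dependence on measurable data *)

Section continuous_dependence.
Context disp (T : measurableType disp) (R : realType) (I : finType).

(* With X the solution of the implicit equation and Y its data, this replaces
   the measurability of a solution map: X only has to exist along D. *)
Lemma measurable_fun_continuous_dependence (D : set T) (Y : I -> T -> R)
    (X : T -> R) :
  measurable D -> (forall i, measurable_fun D (Y i)) ->
  (forall t e, D t -> 0 < e -> exists2 r, 0 < r & forall u, D u ->
     (forall i, `|Y i t - Y i u| < r) -> `|X t - X u| < e) ->
  measurable_fun D X.
Proof.
move=> mD mY XY.
apply: (measurability _ (RGenOInfty.measurableE R)) => //= _ [_ [a ->] <-].
(* Boxes with rational centre and radius are countably many, so the preimage of a half-line is a
   countable union of those boxes that lie inside it. *)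
pose box (c : {ffun I -> rat} * rat) : set T :=
  \bigcap_(i in setT) (D `&` Y i @^-1` `](ratr (c.1 i) - ratr c.2), (ratr (c.1 i) + ratr c.2)[).
pose good := [set c | D `&` box c `<=` X @^-1` `]a, +oo[].
have -> : D `&` X @^-1` `]a, +oo[ = \bigcup_(c in good) (D `&` box c).
  apply/seteqP; split=> [t [Dt]|t [c gc [Dt bt]]]; last by split=> //; exact: gc.
  rewrite /= in_itv/= andbT => aXt.
  have [r r0 Hr] := XY t (X t - a) Dt ltac:(by rewrite subr_gt0).
  (* Two points of a box of radius q differ by less than 2 q in each coordinate, hence the bound r /
     2. *)
  have [q qr] : exists q : rat, ratr q \in `](0:R), (r / 2)[.
    by apply: rat_in_itvoo; rewrite divr_gt0.
  move: qr; rewrite in_itv/= => /andP[q0 qr].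
  have /choice[c Hc] i : exists c : rat, ratr c \in `](Y i t - ratr q), (Y i t + ratr q)[.
    by apply: rat_in_itvoo; lra.
  have Hc' i : (Y i t - ratr q < ratr (c i) < Y i t + ratr q).
    by have := Hc i; rewrite in_itv.
  exists ([ffun i => c i], q); last first.
    split=> // i _; split=> //=; rewrite in_itv/= ffunE.
    by have /andP[] := Hc' i; lra.
  move=> u [Du bu] /=; rewrite in_itv/= andbT.
  have := Hr u Du; have H : forall i, `|Y i t - Y i u| < r.
    move=> i; have [_ ] := bu i Logic.I; rewrite /= in_itv/= ffunE.
    have /andP[] := Hc' i; rewrite ltr_norml => *; apply/andP; split; lra.
  by move=> /(_ H); rewrite ltr_norml => /andP[_]; lra.
rewrite bigcup_mkcond; apply: countable_bigcupT_measurable => // c.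
case: ifPn => // _; apply: measurableI => //.
by apply: fin_bigcap_measurable => // i _; exact: mY.
Qed.

End continuous_dependence.

(** * The past of the particle system and its independence from later increments *)

Lemma measure_eq_negligibleY d (T : measurableType d) (R : realType)
    (mu : {measure set T -> \bar R}) (A B : set T) :
  measurable A -> measurable B -> mu.-negligible (A `+` B) -> mu A = mu B.
Proof.
move=> mA mB [N [mN N0 AB]].
have le C D : measurable C -> measurable D -> C `\` D `<=` N -> (mu C <= mu D)%E.
  move=> mC mD CD.
  have : (mu C <= mu (D `|` N))%E.
    apply: le_measure; rewrite ?inE//; first exact: measurableU.
    by move=> x Cx; have [Dx|Dx] := pselect (D x); [left|right; exact: CD].
  move/le_trans; apply; apply: le_trans (measureU2 mu mD mN) _.
  by rewrite [X in (_ + X)%E]N0 adde0.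
by apply/eqP; rewrite eq_le !le// => x Hx; apply: AB; [right|left].
Qed.

Section past.
Local Open Scope ereal_scope.
Context (R : realType) (disp : measure_display) (Omega : measurableType disp)
  (P : probability Omega R) (F : R -> set (set Omega)) (d m n : nat)
  (X0 : Omega -> 'cV[R]_d) (W : R -> Omega -> 'cV[R]_m)
  (X0c : 'I_n.+1 -> Omega -> 'cV[R]_d) (Wc : 'I_n.+1 -> R -> Omega -> 'cV[R]_m).
Hypothesis hF : usual_conditions P F.
Hypothesis hX0_meas : measurable_wrt (F 0%R) X0.
Hypothesis hW : brownian_motion P F W.
Hypothesis hcopies : independent_copies P W X0 Wc X0c.

Local Notation path := ((R -> 'cV[R]_m) * 'cV[R]_d)%type.

(** The past lives on path space, because [independent_copies] compares the copies with (W, X_0)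
    through events of that space. *)
Definition past_cylinders (t : R) : set (set path) :=
  [set E | (exists s, (0 <= s <= t)%R /\ exists2 B, measurable B &
              E = [set w : path | B (w.1 s)])
         \/ (exists2 B, measurable B & E = [set w : path | B w.2])].

Definition past_events (t : R) : set (set path) := <<s past_cylinders t >>.

(* This pi-system contains all null sets, because the scheme determines Z only
   almost surely. *)
Definition observable (t : R) : set (set Omega) :=
  [set A | exists2 E : 'I_n.+1 -> set path, (forall j, past_events t (E j)) &
    P.-negligible (A `+`
      \bigcap_(j in setT) path_preimage (Wc j) (X0c j) (E j))].

Lemma past_events_path (t : R) : past_events t `<=` @path_events R d m.
Proof.
apply: sub_sigma_algebra2 => E [[s [/andP[s0 _] [B mB ->]]]|HB].
  by left; exists s; split => //; exists B.
by right.
Qed.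

Lemma past_events_le (s t : R) : (s <= t)%R -> past_events s `<=` past_events t.
Proof.
move=> st; apply: sub_sigma_algebra2 => E [[u [/andP[u0 us] HB]]|HB].
  by left; exists u; split => //; rewrite u0 (le_trans us).
by right.
Qed.

Lemma observable_le (s t : R) : (s <= t)%R -> observable s `<=` observable t.
Proof.
by move=> st A [E HE HA]; exists E => // j; exact: past_events_le (HE j).
Qed.

Lemma past_eventsI (t : R) A B :
  past_events t A -> past_events t B -> past_events t (A `&` B).
Proof. exact: (@measurableI _ (g_sigma_algebraType (past_cylinders t))). Qed.

Lemma past_events_setT (t : R) : past_events t setT.
Proof. exact: (@measurableT _ (g_sigma_algebraType (past_cylinders t))). Qed.

Lemma observableI (t : R) : setI_closed (observable t).
Proof.
move=> A B [E HE HA] [E' HE' HB].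
exists (fun j => E j `&` E' j) => [j|]; first exact: past_eventsI.
apply: negligibleS (negligibleU HA HB) => w; rewrite /setY /=.
case=> [[[Aw Bw] H]|[H AB]].
- have [HAw|HAw] := pselect ((\bigcap_(j in [set: 'I_n.+1])
    path_preimage (Wc j) (X0c j) (E j)) w).
  + right; left; split=> // HBw; apply: H => j _.
    by split; [exact: HAw|exact: HBw].
  + by left; left.
- have [Aw|Aw] := pselect (A w).
  + right; right; split; last by move=> Bw; exact: AB.
    by move=> j _; have [] := H j Logic.I.
  + left; right; split=> // j _.
    by have [] := H j Logic.I.
Qed.

Lemma observable_negligible (t : R) (N : set Omega) :
  P.-negligible N -> observable t N.
Proof.
(* The intersection is empty as well, since there is an index [ord0]. *)
move=> HN; exists (fun _ => set0) => [j|].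
  exact: (@measurable0 _ (g_sigma_algebraType (past_cylinders t))).
apply: negligibleS HN => w [[]//|[/(_ ord0 Logic.I)//]].
Qed.

Lemma observable_past (t : R) (j : 'I_n.+1) (E : set path) :
  past_events t E -> observable t (path_preimage (Wc j) (X0c j) E).
Proof.
move=> HE; exists (fun i => if i == j then E else setT) => [i|].
  by case: ifP => // _; exact: past_events_setT.
rewrite [X in _.-negligible X](_ : _ = set0); first exact: negligible_set0.
rewrite -subset0 => w [[Ew]|[H]]; apply.
  by move=> i _; case: ifPn => // /eqP ->.
by have := H j Logic.I; rewrite eqxx.
Qed.

Lemma measurable_path_bigcap (E : 'I_n.+1 -> set path) :
  (forall j, path_events (E j)) ->
  measurable (\bigcap_(j in setT) path_preimage (Wc j) (X0c j) (E j)).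
Proof.
move=> HE; apply: fin_bigcap_measurable => // j _.
by case: hcopies => /(_ j (E j) (HE j))[].
Qed.

Lemma negligible_measurable (N : set Omega) : P.-negligible N -> measurable N.
Proof. by case: hF => + _ _ _ _; apply. Qed.

(** Completeness of P enters here: an observable event differs from a measurable one by subsets of
    null sets, and these are measurable. *)
Lemma observable_measurable (t : R) : observable t `<=` measurable.
Proof.
move=> A [E HE HA]; set B := \bigcap_(j in _) _ in HA.
have mB : measurable B.
  by apply: measurable_path_bigcap => j; apply: past_events_path; exact: HE.
have mAB : measurable (A `\` B).
  by apply/negligible_measurable/(negligibleS _ HA) => x; left.
have mBA : measurable (B `\` A).
  by apply/negligible_measurable/(negligibleS _ HA) => x; right.
rewrite (_ : A = (A `\` B) `|` (B `\` (B `\` A))).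
  by apply: measurableU => //; exact: measurableD.
apply/seteqP; split => x /=.
  by have [Bx|Bx] := pselect (B x) => Ax; [right; split=> // -[]|left].
by case=> [[]//|[Bx]]; have [//|Ax []] := pselect (A x).
Qed.

Lemma measurable_past (t : R) :
  <<s observable t >> `<=` measurable.
Proof.
apply: smallest_sub; last exact: observable_measurable.
exact: sigma_algebra_measurable.
Qed.


Section increment.
Variables (t u : R) (i : 'I_n.+1) (j : 'I_m).
Hypotheses (t0 : (0 <= t)%R) (tu : (t < u)%R).

Let u0 : (0 <= u)%R := le_trans t0 (ltW tu).

Definition increment_event (B : set R) : set path :=
  [set w : path | B ((w.1 u - w.1 t)%R j 0%R)].

(** The generators of [path_events], named so that path space becomes a measurable type and
    evaluation at a time a measurable function. *)
Let path_cylinders : set (set path) :=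
  [set E | (exists t, (0 <= t)%R /\ exists2 B, measurable B &
              E = [set w : path | B (w.1 t)])
         \/ (exists2 B, measurable B & E = [set w : path | B w.2])].

Let measurable_path_coord (s : R) : (0 <= s)%R ->
  measurable_fun (setT : set (g_sigma_algebraType path_cylinders))
    (fun w : path => w.1 s j 0%R).
Proof.
move=> s0 _ B mB; rewrite setTI; apply: sub_sigma_algebra; left.
exists s; split => //; exists ((fun x : 'cV[R]_m => x j 0%R) @^-1` B) => //.
by rewrite -[X in measurable X]setTI; exact: measurable_coord.
Qed.

Lemma path_increment_event (B : set R) : measurable B ->
  path_events (increment_event B).
Proof.
move=> mB.
have : measurable_fun (setT : set (g_sigma_algebraType path_cylinders))
    (fun w : path => w.1 u j 0 - w.1 t j 0)%R.
  by apply: measurable_funB; exact: measurable_path_coord.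
move=> /(_ measurableT B mB); rewrite setTI.
by congr (path_events _); apply/funext => w; rewrite /increment_event/= !mxE.
Qed.

(** The pair (W, X_0) is adapted, so its past lies in [F t], from which the increments of W after t
    are independent. *)
Let preimage_past (E : set path) :
  past_events t E -> F t (path_preimage W X0 E).
Proof.
case: hF => _ Fsigma Fmono _ _; case: hW => Wadapted _ _ _ _.
have [sFt _] := Fsigma t t0.
move: E; apply: smallest_sub => [|E].
  case: sFt => F0 FC FU; split=> [|A HA|A HA].
  - exact: F0.
  - exact: FC HA.
  - exact: FU HA.
move=> [[s [/andP[s0 st] [B mB ->]]]|[B mB ->]].
  by apply: (Fmono s) => //; exact: Wadapted.
by apply: (Fmono 0%R) => //; exact: hX0_meas.
Qed.

Lemma increment_law (B : set R) : measurable B ->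
  P (path_preimage (Wc i) (X0c i) (increment_event B)) =
  normal_prob 0 (Num.sqrt (u - t)) B.
Proof.
move=> mB; have [/(_ i _ (path_increment_event mB))[_ ->] _ _] := hcopies.
case: hW => _ _ _ normal_inc _.
(* The joint law of the coordinates is read off at coordinate [j] by putting no constraint on the
   others. *)
have := normal_inc t u t0 tu (fun k => if k == j then B else setT).
rewrite (bigD1 j)//= eqxx big1 ?mule1; last first.
  by move=> k /negPf ->; exact: probability_setT.
move=> <-; last by move=> k; case: ifP.
congr (P _); apply/seteqP; split => w /=.
  by move=> H k; case: ifPn => // /eqP ->.
by move=> /(_ j); rewrite eqxx.
Qed.

(** All three events are path events, so their probabilities may be computed for (W, X_0), where the
    past belongs to [F t]. *)
Let past_increment_independent (E : set path) (B : set R) :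
  past_events t E -> measurable B ->
  P (path_preimage (Wc i) (X0c i) (E `&` increment_event B)) =
  P (path_preimage (Wc i) (X0c i) E) *
  P (path_preimage (Wc i) (X0c i) (increment_event B)).
Proof.
move=> HE mB.
have pB := path_increment_event mB; have pE := past_events_path HE.
have pEB : path_events (E `&` increment_event B).
  exact: (@measurableI _ (g_sigma_algebraType path_cylinders)).
have [law _ _] := hcopies.
have [_ ->] := law i _ pEB; have [_ ->] := law i _ pB; have [_ ->] := law i _ pE.
case: hW => _ _ indep _ _.
apply: (indep t u t0 tu (path_preimage W X0 E) [set x | B (x j 0%R)]).
  exact: preimage_past.
by rewrite -[X in measurable X]setTI; exact: measurable_coord.
Qed.

Lemma measurable_increment_event (B : set R) : measurable B ->
  measurable (path_preimage (Wc i) (X0c i) (increment_event B)).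
Proof.
by move=> mB; case: hcopies => /(_ i _ (path_increment_event mB))[].
Qed.

(** Dynkin induction on the pi-system [observable t]. A generator may be replaced by its
    intersection of path events, up to a null set; independence of the copies then leaves one
    factor, copy [i], in which past and increment have to be separated. *)
Lemma observable_increment_independent (A : set Omega) (B : set R) :
  <<s observable t >> A -> measurable B ->
  P (A `&` path_preimage (Wc i) (X0c i) (increment_event B)) =
  P A * P (path_preimage (Wc i) (X0c i) (increment_event B)).
Proof.
move=> HA mB; set D := path_preimage _ _ (increment_event B).
have mD : measurable D by exact: measurable_increment_event.
have mobs S : <<s observable t >> S -> measurable S by exact: measurable_past.
apply: (@dynkin_induction _ (g_sigma_algebraType (observable t)) (observable t)
  (fun A => P (A `&` D) = P A * P D)) HA => //.
- exact: observableI.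
- by rewrite setTI probability_setT mul1e.
- move=> S oS; have mS := observable_measurable oS; case: oS => E HE HS.
  set C := \bigcap_(j in _) _ in HS.
  have pE k : path_events (E k) by exact: past_events_path (HE k).
  have mC : measurable C by exact: measurable_path_bigcap.
  have PSC (G : set Omega) : measurable G -> P (S `&` G) = P (C `&` G).
    move=> mG; apply: measure_eq_negligibleY.
    - exact: measurableI mS mG.
    - exact: measurableI mC mG.
    by apply: negligibleS HS => w; rewrite /setY/=; tauto.
  rewrite PSC// -[in RHS](setIT S) PSC// setIT.
  have [law indep _] := hcopies.
  (* The increment event is absorbed into factor [i], so that both sides become products over the
     copies. *)
  have -> : C `&` D = \bigcap_(k in setT) path_preimage (Wc k) (X0c k)
      (if k == i then E k `&` increment_event B else E k).
    apply/seteqP; split=> w.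
      by move=> [Cw Dw] k _; case: ifPn => [/eqP ki|_]; [split; [exact: Cw|rewrite ki]|exact: Cw].
    move=> H; split.
      by move=> k _; have := H k Logic.I; case: ifPn => // _ [].
    by have := H i Logic.I; rewrite eqxx => -[].
  rewrite !indep//; last first.
    move=> k; case: ifPn => [/eqP ->|//].
    exact: (@measurableI _ (g_sigma_algebraType path_cylinders) _ _
      (pE i) (path_increment_event mB)).
  rewrite (bigD1 i)//= eqxx past_increment_independent// [in RHS](bigD1 i)//=.
  rewrite muleAC; congr (_ * _ * _).
  by apply: eq_bigr => k /negPf ->.
- move=> S mS PS; have mS' := mobs _ mS.
  have -> : P (~` S `&` D) = P D - P S * P D.
    rewrite -PS setIC -setDE measureD//; last first.
      by rewrite -ge0_fin_numE// fin_num_measure.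
    by rewrite [D `&` S]setIC.
  have PSf := fin_num_measure P S mS'; have PDf := fin_num_measure P D mD.
  by rewrite probability_setC// muleBl ?mul1e.
- move=> G mG tG PG; have mG' k := mobs _ (mG k).
  rewrite setI_bigcupl !measure_semi_bigcup//.
  - have PDf := fin_num_measure P D mD.
    rewrite muleC -(fineK PDf) -nneseriesZl//.
    by apply: eq_eseriesr => k _; rewrite (fineK PDf) muleC; exact: PG.
  - exact: bigcupT_measurable.
  - by move=> k; exact: measurableI.
  - exact: trivIset_setIr.
  - by apply: bigcupT_measurable => k; exact: measurableI.
Qed.

Definition increment (w : Omega) : R := (Wc i u w - Wc i t w)%R j 0%R.

Lemma measurable_increment : measurable_fun setT increment.
Proof. by move=> _ B mB; rewrite setTI; exact: measurable_increment_event. Qed.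

Lemma ge0_integral_increment (g : R -> \bar R) :
  measurable_fun setT g -> (forall x, 0 <= g x) ->
  \int[P]_w g (increment w) =
  \int[normal_prob 0 (Num.sqrt (u - t))]_x g x.
Proof.
move=> mg g0.
have mincr : measurable_fun setT (increment : Omega -> measurableTypeR R).
  by move=> _ B mB; rewrite setTI; exact: measurable_increment_event.
pose X : {mfun Omega >-> measurableTypeR R} :=
  @mfun_Sub _ _ Omega (measurableTypeR R) _ (mem_set mincr).
transitivity (\int[distribution P X]_x g x).
  by rewrite ge0_integral_distribution.
apply: eq_measure_integral.
by move=> B mB _; exact: increment_law.
Qed.

Lemma integral_sqr_increment_le :
  \int[P]_w (increment w ^+ 2)%:E <= (u - t)%:E.
Proof.
rewrite (ge0_integral_increment (g := fun x => (x ^+ 2)%:E)); last 2 first.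
- by apply/measurable_EFinP; exact: measurable_funX.
- by move=> x; rewrite lee_fin sqr_ge0.
have ut : (0 < u - t)%R by rewrite subr_gt0.
rewrite -[in leRHS](sqr_sqrtr (ltW ut)).
by apply: integral_sqr_normal_le; rewrite sqrtr_gt0.
Qed.

Lemma integrable_sqr_increment :
  P.-integrable setT (fun w => (increment w ^+ 2)%:E).
Proof.
apply/integrableP; split.
  by apply/measurable_EFinP; apply: measurable_funX; exact: measurable_increment.
under eq_integral do rewrite gee0_abs ?lee_fin ?sqr_ge0//.
by rewrite (le_lt_trans integral_sqr_increment_le)// ltry.
Qed.

Lemma integrable_increment : P.-integrable setT (EFin \o increment).
Proof.
apply: (@le_integrable _ _ _ P setT _ _ (fun w => (1 + increment w ^+ 2)%:E)) => //.
- by apply/measurable_EFinP; exact: measurable_increment.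
- move=> w _; rewrite /= lee_fin [leRHS]ger0_norm ?addr_ge0 ?sqr_ge0//.
  rewrite ler_norml; apply/andP.
  by have := sqr_ge0 (increment w - 1); have := sqr_ge0 (increment w + 1);
    rewrite sqrrB sqrrD; split; nra.
- under eq_fun do rewrite EFinD.
  apply: integrableD => //; last exact: integrable_sqr_increment.
  exact: finite_measure_integrable_cst.
Qed.

Lemma integral_increment0 : \int[P]_w (increment w)%:E = 0.
Proof.
have ut : (0 < u - t)%R by rewrite subr_gt0.
rewrite -(@integral_id_normal R (Num.sqrt (u - t))) ?sqrtr_gt0//.
(* The law is transferred for nonnegative functions only, hence the positive and negative parts are
   treated separately. *)
rewrite [LHS]integralE [RHS]integralE.
rewrite -(ge0_integral_increment (g := (EFin : R -> \bar R)^\+))//; last first.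
  by apply: measurable_funepos; exact/measurable_EFinP.
rewrite -(ge0_integral_increment (g := (EFin : R -> \bar R)^\-))//; last first.
  by apply: measurable_funeneg; exact/measurable_EFinP.
by congr (_ - _); apply: eq_integral => w _; rewrite ?funeposE ?funenegE.
Qed.

Lemma increment_independent (X : Omega -> R) :
  measurable_fun (setT : set (g_sigma_algebraType (observable t))) X ->
  independent_rv P X increment.
Proof.
move=> mX A B mA mB; apply: observable_increment_independent => //.
by have := mX measurableT A mA; rewrite setTI.
Qed.


End increment.

Lemma observable_full (t : R) (D : set Omega) :
  P.-negligible (~` D) -> <<s observable t >> D.
Proof.
move=> HD; rewrite -[D]setCK.
apply: (@measurableC _ (g_sigma_algebraType (observable t))).
by apply: sub_sigma_algebra; exact: observable_negligible.
Qed.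

(** The equations of the scheme hold almost surely, so measurability is proved on a set D of full
    measure; what happens outside D is a null event, which is observable. *)
Lemma measurable_observable_full (t : R) (D : set Omega) (X : Omega -> R) :
  P.-negligible (~` D) ->
  measurable_fun (D : set (g_sigma_algebraType (observable t))) X ->
  measurable_fun (setT : set (g_sigma_algebraType (observable t))) X.
Proof.
move=> HD mX _ B mB; rewrite setTI -(setIT (X @^-1` B)) -(setUv D) setIUr.
apply: measurableU.
  by rewrite setIC; apply: mX => //; exact: observable_full.
apply: sub_sigma_algebra; apply: observable_negligible.
by apply: negligibleS HD => w [].
Qed.

Lemma measurable_observable_le (s t : R) (X : Omega -> R) : (s <= t)%R ->
  measurable_fun (setT : set (g_sigma_algebraType (observable s))) X ->
  measurable_fun (setT : set (g_sigma_algebraType (observable t))) X.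
Proof.
move=> st mX _ B mB; apply: (sub_sigma_algebra2 (observable_le st)).
exact: mX.
Qed.

Lemma measurable_observable_measurable (t : R) (X : Omega -> R) :
  measurable_fun (setT : set (g_sigma_algebraType (observable t))) X ->
  measurable_fun setT X.
Proof. by move=> mX _ B mB; apply: measurable_past; exact: mX. Qed.

Lemma measurable_observable_init (t : R) (j : 'I_n.+1) (i : 'I_d) :
  measurable_fun (setT : set (g_sigma_algebraType (observable t)))
    (fun w => X0c j w i 0%R).
Proof.
move=> _ B mB; rewrite setTI; apply: sub_sigma_algebra.
apply: (@observable_past t j [set w : path | B (w.2 i 0%R)]).
apply: sub_sigma_algebra; right; exists [set x : 'cV[R]_d | B (x i 0%R)] => //.
by rewrite -[X in measurable X]setTI; exact: measurable_coord.
Qed.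

Lemma measurable_observable_path (s t : R) (j : 'I_n.+1) (i : 'I_m) :
  (0 <= s <= t)%R ->
  measurable_fun (setT : set (g_sigma_algebraType (observable t)))
    (fun w => Wc j s w i 0%R).
Proof.
move=> st _ B mB; rewrite setTI; apply: sub_sigma_algebra.
apply: (@observable_past t j [set w : path | B (w.1 s i 0%R)]).
apply: sub_sigma_algebra; left; exists s; split=> //.
exists [set x : 'cV[R]_m | B (x i 0%R)] => //.
by rewrite -[X in measurable X]setTI; exact: measurable_coord.
Qed.

End past.

(** * One implicit step: dissipation and stability *)

Section implicit_step.
Context (R : realType) (d : nat) (b : 'cV[R]_d -> P2 R d -> 'cV[R]_d).

(** Expand |u|^2 = |x - Delta b|^2. The term Delta^2 |b|^2 has the good sign and is dropped, so
    neither growth of b nor a small stepsize matters. *)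
Lemma implicit_step_dissipative (c1 c2 Delta : R) (x u : 'cV[R]_d)
    (mu : P2 R d) :
  0 <= Delta ->
  2 * dot x (b x mu) <= - c1 * frob x ^+ 2 + c2 * second_moment_norm mu ^+ 2 ->
  x = u + Delta *: b x mu ->
  (1 + c1 * Delta) * frob x ^+ 2 <=
  frob u ^+ 2 + c2 * Delta * second_moment_norm mu ^+ 2.
Proof.
move=> D0 drift xE.
have -> : u = x + (- Delta) *: b x mu by rewrite scaleNr {1}xE addrK.
rewrite sqr_frobD dotZr; have := sqr_ge0 (frob (- Delta *: b x mu)); nra.
Qed.

(** Pair u - v = (x - y) - Delta (b(x, mu) - b(y, nu)) with 2 (x - y). Monotonicity bounds the drift
    part, and 2 <x - y, u - v> <= |x - y|^2 + |u - v|^2 leaves one |x - y|^2 on the left. *)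
Lemma implicit_step_continuous (q : nat)
    (sigma : 'cV[R]_d -> P2 R d -> 'M[R]_(d, q)) (K1 K2 Delta : R)
    (x y u v : 'cV[R]_d) (mu nu : P2 R d) :
  0 <= K1 -> 0 <= Delta ->
  2 * dot (x - y) (b x mu - b y nu) + frob (sigma x mu - sigma y nu) ^+ 2 <=
    - K1 * frob (x - y) ^+ 2 + K2 * W2 mu nu ^+ 2 ->
  x = u + Delta *: b x mu -> y = v + Delta *: b y nu ->
  frob (x - y) ^+ 2 <= frob (u - v) ^+ 2 + Delta * K2 * W2 mu nu ^+ 2.
Proof.
move=> K10 D0 mono xE yE.
have uvE : u - v = (x - y) - Delta *: (b x mu - b y nu).
  have -> : u = x - Delta *: b x mu by rewrite {1}xE addrK.
  have -> : v = y - Delta *: b y nu by rewrite {1}yE addrK.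
  by apply/matrixP => i j; rewrite !mxE; ring.
have := dot_le (x - y) (u - v).
rewrite {1}uvE dotBr dotxx dotZr.
have := mulr_ge0 D0 (sqr_ge0 (frob (sigma x mu - sigma y nu))).
have := mulr_ge0 (mulr_ge0 D0 K10) (sqr_ge0 (frob (x - y))).
have := ler_wpM2l D0 mono.
rewrite !mulrDr; lra.
Qed.

End implicit_step.

(** * Continuity of the diffusion coefficient in the particle positions *)

Section diffusion_continuous.
Context (R : realType) (d q n : nat)
  (sigma : 'cV[R]_d -> P2 R d -> 'M[R]_(d, q)) (K2 : R).
Hypothesis K20 : 0 <= K2.
Hypothesis sigma_lip : forall mu, locally_lipschitz (sigma ^~ mu).
Hypothesis sigma_W2 : forall x mu nu,
  frob (sigma x mu - sigma x nu) ^+ 2 <= K2 * W2 mu nu ^+ 2.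

Lemma sqr_frob_lt_coord (r : R) (x y : 'cV[R]_d) :
  (forall a, `|x a 0 - y a 0| < r) -> frob (x - y) ^+ 2 <= d%:R * r ^+ 2.
Proof.
move=> xy; rewrite sqr_frob_col mulr_natl -[X in _ *+ X](card_ord d) -sumr_const.
apply: ler_sum => a _; rewrite !mxE -[leLHS]real_normK ?num_real//.
by rewrite ler_sqr ?nnegrE// ?ltW//; exact: le_lt_trans (normr_ge0 _) (xy a).
Qed.

Lemma sqr_W2_empirical_lt_coord (r : R) (z w : 'I_n.+1 -> 'cV[R]_d) :
  (forall i a, `|z i a 0 - w i a 0| < r) ->
  W2 (empirical z) (empirical w) ^+ 2 <= d%:R * r ^+ 2.
Proof.
move=> zw; apply: le_trans (sqr_W2_empirical_le _ _) _.
rewrite ler_pdivrMl// (mulr_natl (d%:R * r ^+ 2)) -[X in _ *+ X](card_ord n.+1) -sumr_const.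
by apply: ler_sum => i _; exact: sqr_frob_lt_coord.
Qed.

(** The difference is split at sigma(w_i, mu_z). The Lipschitz constant in x may depend on the
    measure, so the first part must keep the fixed measure mu_z; the second part is controlled by
    W2. *)
Lemma diffusion_continuous (z : 'I_n.+1 -> 'cV[R]_d) (i : 'I_n.+1) (e : R) :
  0 < e -> exists2 r, 0 < r & forall w : 'I_n.+1 -> 'cV[R]_d,
    (forall i a, `|z i a 0 - w i a 0| < r) ->
    frob (sigma (z i) (empirical z) - sigma (w i) (empirical w)) < e.
Proof.
(* A ball containing z_i and all w_i with coordinates within 1 of it: |w_i|^2 <= 2 (|z_i|^2 + d),
   and |x| <= |x|^2 + 1 avoids a square root. *)
move=> e0; pose r0 := frob (z i) ^+ 2 + 2 * (frob (z i) ^+ 2 + d%:R) + 1.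
have [L HL] := sigma_lip (empirical z) r0.
(* The squared difference is at most (A - 1) r^2. The extra 1 gives strictness and A >= 1, so that r
   <= e / A implies A r^2 <= e^2. *)
pose A := 1 + 2 * d%:R * (L ^+ 2 + K2).
have A1 : 1 <= A by rewrite lerDl !mulr_ge0// addr_ge0// sqr_ge0.
have A0 : 0 < A by exact: lt_le_trans A1.
exists (Num.min 1 (e / A)); first by rewrite lt_min ltr01 divr_gt0.
move=> w; set r := Num.min _ _ => zw.
have r0' : 0 < r by rewrite lt_min ltr01 divr_gt0.
have r1 : r <= 1 by rewrite ge_min lexx.
have rA : A * r ^+ 2 <= e ^+ 2.
  have : r <= e / A by rewrite ge_min lexx orbT.
  rewrite ler_pdivlMr// => H.
  have : (r * A) ^+ 2 <= e ^+ 2.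
    by rewrite ler_sqr ?nnegrE ?mulr_ge0 ?(ltW r0') ?(ltW A0) ?(ltW e0).
  apply: le_trans; rewrite exprMn mulrC ler_wpM2l ?sqr_ge0//.
  by rewrite expr2 ler_peMr// ltW.
have zwi := sqr_frob_lt_coord (zw i).
have zwW := sqr_W2_empirical_lt_coord zw.
have d0 : 0 <= d%:R :> R by [].
have rr : r ^+ 2 <= 1 by rewrite expr_le1// ltW.
have wi : frob (w i) <= r0.
  have := sqr_frobD_le (z i) (- (z i - w i)).
  have -> : z i - (z i - w i) = w i by rewrite opprB addrC subrK.
  have -> : frob (- (z i - w i)) ^+ 2 = frob (z i - w i) ^+ 2.
    by rewrite !sqr_frob_col; apply: eq_bigr => a _; rewrite !mxE sqrrN.
  have := sqr_ge0 (frob (w i) - 1); have := sqr_ge0 (frob (w i)).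
  have := sqr_ge0 (frob (z i)); rewrite /r0 sqrrB; nra.
have zi : frob (z i) <= r0.
  have := sqr_ge0 (frob (z i) - 1); have := sqr_ge0 (frob (z i)).
  rewrite /r0 sqrrB; nra.
have lip := HL _ _ zi wi.
have lip2 : frob (sigma (z i) (empirical z) - sigma (w i) (empirical z)) ^+ 2 <=
    L ^+ 2 * (d%:R * r ^+ 2).
  apply: (@le_trans _ _ ((L * frob (z i - w i)) ^+ 2)).
    by rewrite ler_sqr ?nnegrE ?frob_ge0//; exact: le_trans (frob_ge0 _) lip.
  by rewrite exprMn ler_wpM2l ?sqr_ge0.
have W2' := sigma_W2 (w i) (empirical z) (empirical w).
rewrite -(ltr_sqr (x := frob _)) ?nnegrE ?frob_ge0 ?(ltW e0)//.
have := sqr_frobD_le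
  (sigma (z i) (empirical z) - sigma (w i) (empirical z))
  (sigma (w i) (empirical z) - sigma (w i) (empirical w)).
rewrite addrA subrK => H.
apply: (le_lt_trans H); apply: lt_le_trans rA.
have : K2 * W2 (empirical z) (empirical w) ^+ 2 <= K2 * (d%:R * r ^+ 2).
  by rewrite ler_wpM2l.
have : 0 < r ^+ 2 by rewrite exprn_gt0.
rewrite /A; nra.
Qed.

End diffusion_continuous.

(** * The scheme is measurable with respect to the past *)

Section scheme_measurable.
Context (R : realType) (disp : measure_display) (Omega : measurableType disp)
  (P : probability Omega R) (d m n : nat)
  (b : 'cV[R]_d -> P2 R d -> 'cV[R]_d)
  (sigma : 'cV[R]_d -> P2 R d -> 'M[R]_(d, m))
  (X0c : 'I_n.+1 -> Omega -> 'cV[R]_d) (Wc : 'I_n.+1 -> R -> Omega -> 'cV[R]_m)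
  (K1 K2 Delta : R) (Z : nat -> 'I_n.+1 -> Omega -> 'cV[R]_d).
Hypothesis sigma_lip : forall mu, locally_lipschitz (sigma ^~ mu).
Hypotheses (K1_ge0 : 0 <= K1) (K2_ge0 : 0 <= K2) (Delta_gt0 : 0 < Delta).
Hypothesis mono : forall (x y : 'cV[R]_d) (mu nu : P2 R d),
  2 * dot (x - y) (b x mu - b y nu) + frob (sigma x mu - sigma y nu) ^+ 2
  <= - K1 * frob (x - y) ^+ 2 + K2 * W2 mu nu ^+ 2.
Hypothesis scheme : backward_EM P b sigma Wc X0c Delta Z.

Local Notation obs t := (g_sigma_algebraType (observable P X0c Wc t)).
Local Notation mu k w := (empirical (fun i => Z k i w)).

(** Monotonicity at y = x: the inner product and the K1 term vanish. *)
Let sigma_W2 x mu nu : frob (sigma x mu - sigma x nu) ^+ 2 <= K2 * W2 mu nu ^+ 2.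
Proof.
have := mono x x mu nu; rewrite subrr.
rewrite (_ : dot 0 _ = 0); last by apply: big1 => i _; rewrite mxE mul0r.
by rewrite -dotxx (_ : dot 0 _ = 0) ?mulr0 ?add0r//; apply: big1 => i _;
  rewrite mxE mul0r.
Qed.

(** Continuity in the finitely many particle coordinates replaces a discussion of measurable maps
    into [P2]. *)
Lemma measurable_diffusion_observable (k : nat) :
  (forall i a, measurable_fun (setT : set (obs (k%:R * Delta)))
     (fun w => Z k i w a 0)) ->
  forall j a l, measurable_fun (setT : set (obs (k%:R * Delta)))
    (fun w => sigma (Z k j w) (mu k w) a l).
Proof.
move=> mZ j a l.
apply: (@measurable_fun_continuous_dependence _ (obs (k%:R * Delta)) R ('I_n.+1 * 'I_d)%type _
  (fun ia w => Z k ia.1 w ia.2 0)) => // w e _ e0.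
have [r r0 Hr] := diffusion_continuous K2_ge0 sigma_lip sigma_W2
  (fun i => Z k i w) j e0.
exists r => // v _ Zv; apply: le_lt_trans (Hr (fun i => Z k i v) _); last first.
  by move=> i c; exact: (Zv (i, c)).
rewrite -ler_sqr ?nnegrE ?frob_ge0// real_normK ?num_real//.
by apply: le_trans (ler_sqr_frob _ a l); rewrite !mxE.
Qed.

Lemma measurable_scheme_observable (k : nat) i a :
  measurable_fun (setT : set (obs (k%:R * Delta))) (fun w => Z k i w a 0).
Proof.
have [_ Z0 ZS] := scheme.
elim: k i a => [|k IH] i a.
  pose D := [set w | Z 0 i w = X0c i w].
  apply: (@measurable_observable_full _ _ _ _ _ _ _ _ _ _ D).
    exact: Z0.
  apply: (@eq_measurable_fun _ _ (obs (0%:R * Delta)) R D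
    (fun w => X0c i w a 0)) => [w|].
    by rewrite inE => /= ->.
  apply: (@measurable_funS _ _ _ _ setT) => //.
  exact: measurable_observable_init.
have kD : k%:R * Delta <= k.+1%:R * Delta by rewrite ler_pM2r// ler_nat.
have k0 : 0 <= k%:R * Delta by rewrite mulr_ge0// ltW.
have mZ j c := measurable_observable_le kD (IH j c).
have ms j c l := measurable_observable_le kD (measurable_diffusion_observable IH j c l).
have mW s l : 0 <= s <= k.+1%:R * Delta ->
    measurable_fun (setT : set (obs (k.+1%:R * Delta))) (fun w => Wc i s w l 0).
  exact: measurable_observable_path.
pose dW w := Wc i (k.+1%:R * Delta) w - Wc i (k%:R * Delta) w.
pose u w := Z k i w + sigma (Z k i w) (mu k w) *m dW w.
have mu_ c : measurable_fun (setT : set (obs (k.+1%:R * Delta))) (fun w => u w c 0).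
  rewrite (_ : (fun w => u w c 0) = (fun w => Z k i w c 0 +
    \sum_l sigma (Z k i w) (mu k w) c l *
      (Wc i (k.+1%:R * Delta) w l 0 - Wc i (k%:R * Delta) w l 0))); last first.
    by apply/funext => w; rewrite !mxE; under eq_bigr do rewrite !mxE.
  apply: measurable_funD; first exact: mZ.
  apply: measurable_sum => l; apply: measurable_funM; first exact: ms.
  by apply: measurable_funB; apply: mW; rewrite ?k0 ?kD ?(le_trans k0 kD) ?lexx.
(* The implicit equation with all explicit terms collected in [u]; it holds on D, a set of full
   measure. *)
pose D := [set w | Z k.+1 i w = u w + Delta *: b (Z k.+1 i w) (mu k w)].
have HD : P.-negligible (~` D).
  apply: negligibleS (ZS k i) => w /= nD H; apply: nD.
  by rewrite /D/= {1}H /u /dW -!addrA; congr (_ + _); rewrite addrC.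
apply: (measurable_observable_full HD).
(* The data are all coordinates of all particles, which enter through the empirical measure, and the
   explicit part of particle [i]. *)
apply: (@measurable_fun_continuous_dependence _ (obs (k.+1%:R * Delta)) R
  ('I_n.+1 * 'I_d + 'I_d)%type D
  (fun s w => match s with inl ia => Z k ia.1 w ia.2 0 | inr c => u w c 0 end)).
- exact: observable_full.
- by move=> [[j c]|c]; apply: (@measurable_funS _ _ _ _ setT).
- move=> w e Dw e0.
  (* With coordinates closer than r = e / A, the stability bound gives (d + Delta K2 d) r^2 = (A -
     1) r^2, which is below A r^2 <= e^2. *)
  pose A := 1 + d%:R + Delta * K2 * d%:R.
  have A1 : 1 <= A.
    by rewrite /A -addrA lerDl addr_ge0// !mulr_ge0// ltW.
  have A0 : 0 < A by exact: lt_le_trans A1.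
  exists (e / A) => [|v Dv Yv]; first by rewrite divr_gt0.
  have r0 : 0 < e / A by rewrite divr_gt0.
  have close := implicit_step_continuous K1_ge0 (ltW Delta_gt0)
    (mono (Z k.+1 i w) (Z k.+1 i v) (mu k w) (mu k v)) Dw Dv.
  have uv : frob (u w - u v) ^+ 2 <= d%:R * (e / A) ^+ 2.
    by apply: sqr_frob_lt_coord => c; exact: (Yv (inr c)).
  have W2wv : W2 (mu k w) (mu k v) ^+ 2 <= d%:R * (e / A) ^+ 2.
    by apply: sqr_W2_empirical_lt_coord => j c; exact: (Yv (inl (j, c))).
  rewrite -ltr_sqr ?nnegrE ?(ltW e0)// real_normK ?num_real//.
  have := ler_sqr_frob (Z k.+1 i w - Z k.+1 i v) a 0; rewrite !mxE => H.
  apply: (le_lt_trans H); apply: (le_lt_trans close).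
  have DW : Delta * K2 * W2 (mu k w) (mu k v) ^+ 2 <=
      Delta * K2 * (d%:R * (e / A) ^+ 2).
    by rewrite ler_wpM2l// mulr_ge0// ltW.
  apply: (@le_lt_trans _ _ ((A - 1) * (e / A) ^+ 2)).
    rewrite /A; move: uv DW; set r2 := (e / _) ^+ 2; nra.
  have : A * (e / A) ^+ 2 <= e ^+ 2.
    rewrite expr_div_n mulrCA ler_piMr ?sqr_ge0//.
    by rewrite expr2 invfM mulVKf ?gt_eqF// invf_le1.
  have : 0 < (e / A) ^+ 2 by rewrite exprn_gt0.
  lra.
Qed.

End scheme_measurable.

(** * Expectations of integrable variables and the Borel-Cantelli argument *)

Section mean.
Local Open Scope ereal_scope.
Context d (T : measurableType d) (R : realType) (P : probability T R).
Implicit Types f g : T -> R.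

(** Integrability and value travel together, so that expectations are computed in [R] instead of the
    extended reals. *)
Definition has_mean f (v : R) : Prop :=
  P.-integrable setT (EFin \o f) /\ \int[P]_w (f w)%:E = v%:E.

Lemma integrable_has_mean f :
  P.-integrable setT (EFin \o f) -> exists v, has_mean f v.
Proof.
move=> fi; exists (fine (\int[P]_w (f w)%:E)); split => //.
by rewrite fineK//; exact: integrable_fin_num.
Qed.

Lemma has_mean_unique f u v : has_mean f u -> has_mean f v -> u = v.
Proof. by move=> [_ fu] [_ fv]; move: fu; rewrite fv => -[]. Qed.

Lemma has_mean_measurable f u : has_mean f u -> measurable_fun setT f.
Proof. by move=> [/integrableP[/measurable_EFinP]]. Qed.

Lemma has_mean_cst c : has_mean (cst c) c.
Proof.
split; first exact: finite_measure_integrable_cst.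
by rewrite [LHS](integral_cst P measurableT c%:E) [X in _ * X]probability_setT mule1.
Qed.

Lemma has_meanD f g u v : has_mean f u -> has_mean g v ->
  has_mean (fun w => f w + g w)%R (u + v).
Proof.
move=> [fi fu] [gi gv]; split; first exact: (integrableD measurableT fi gi).
by under eq_integral do rewrite EFinD; rewrite integralD// fu gv.
Qed.

Lemma has_meanZ c f u : has_mean f u -> has_mean (fun w => c * f w)%R (c * u).
Proof.
move=> [fi fu]; split; first exact: (integrableZl measurableT c fi).
by under eq_integral do rewrite EFinM; rewrite integralZl// fu.
Qed.

Lemma has_mean_sum (I : finType) (F : I -> T -> R) (v : I -> R) :
  (forall i, has_mean (F i) (v i)) ->
  has_mean (fun w => \sum_i F i w)%R (\sum_i v i).
Proof.
move=> Fv.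
rewrite (_ : (fun w => _) = (\sum_i F i)%R); last first.
  by apply/funext => w; rewrite fct_sumE.
elim/big_ind2 : _ => //.
- exact: (has_mean_cst 0).
- by move=> f u g v' fu gv; exact: has_meanD.
Qed.

Lemma has_mean_le f g u v : (forall w, (f w <= g w)%R) ->
  has_mean f u -> has_mean g v -> (u <= v)%R.
Proof.
move=> fg [fi fu] [gi gv].
by rewrite -lee_fin -fu -gv; apply: le_integral => // w _; rewrite lee_fin.
Qed.

(** This propagates integrability along the scheme: the one-step bound holds almost surely and its
    right side is already known to be integrable. *)
Lemma has_mean_dominated f g v :
  measurable_fun setT f -> (forall w, (0 <= f w)%R) ->
  {ae P, forall w, (f w <= g w)%R} -> has_mean g v ->
  exists2 u, has_mean f u & (u <= v)%R.
Proof.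
move=> mf f0 fg gv; have [gi gE] := gv; have mg := has_mean_measurable gv.
have fv : \int[P]_w (f w)%:E <= v%:E.
  rewrite -gE.
  (* [g] may be negative on a null set; its positive part has the same integral and suits the
     comparison of nonnegative functions. *)
  rewrite -(@ae_eq_integral _ _ _ P setT (EFin \o g)
    (fun w => (Num.max (g w) 0)%:E))//.
  - apply: ae_ge0_le_integral => //.
    + by move=> w _; rewrite lee_fin.
    + exact/measurable_EFinP.
    + by move=> w _; rewrite lee_fin le_max lexx orbT.
    + by apply/measurable_EFinP; exact: measurable_maxr.
    + by apply: filterS fg => w fgw _; rewrite lee_fin le_max fgw.
  - by apply/measurable_EFinP; exact: measurable_maxr.
  - exact/measurable_EFinP.
  - by apply: filterS fg => w fgw _; rewrite /= max_l// (le_trans (f0 w)).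
have fi : P.-integrable setT (EFin \o f).
  apply/integrableP; split; first exact/measurable_EFinP.
  under eq_integral do rewrite gee0_abs ?lee_fin//.
  by rewrite (le_lt_trans fv)// ltry.
have [u fu] := integrable_has_mean fi; exists u => //.
by rewrite -lee_fin -fu.2.
Qed.

Lemma has_mean_independentM0 f g v :
  independent_rv P f g -> has_mean f v -> has_mean g 0 ->
  has_mean (fun w => f w * g w)%R 0.
Proof.
move=> fg [fi _] [gi g0]; split; first exact: integrable_independentM.
by rewrite integral_independentM// g0 mule0.
Qed.

Lemma has_mean_independentM f g u v :
  independent_rv P f g -> has_mean f u -> has_mean g v ->
  has_mean (fun w => f w * g w)%R (u * v).
Proof.
move=> fg [fi fu] [gi gv]; split; first exact: integrable_independentM.
by rewrite integral_independentM// fu gv.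
Qed.

Lemma has_mean_tail_le f v (a : R) : (forall w, (0 <= f w)%R) ->
  has_mean f v -> (0 < a)%R -> P [set w | (a < f w)%R] <= (v / a)%:E.
Proof.
move=> f0 fv a0; have mf := has_mean_measurable fv.
set A := [set w | _].
have mA : measurable A.
  by rewrite /A -[X in measurable X]setTI; exact: measurable_fun_ltr.
have : a%:E * P A <= v%:E.
  rewrite -fv.2 -[X in _ * P X]setIT -integral_indic// -ge0_integralZl//; last 2 first.
  - exact/measurable_EFinP/measurable_indic.
  - by rewrite lee_fin ltW.
  apply: ge0_le_integral => //.
  - by move=> w _; rewrite mule_ge0// lee_fin ltW.
  - by apply: emeasurable_funM => //; exact/measurable_EFinP/measurable_indic.
  - exact/measurable_EFinP.
  - move=> w _; rewrite -EFinM lee_fin indicE.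
    have [/set_mem Aw|_] := boolP (w \in A); last by rewrite mulr0.
    by rewrite mulr1 ltW.
have PAf := fin_num_measure P A mA.
by rewrite -(fineK PAf) -EFinM !lee_fin ler_pdivlMr// mulrC.
Qed.

(** By Markov, f_k exceeds r^k with probability at most C (q / r)^k, the general term of a
    convergent geometric series. *)
Lemma ae_eventually_le (f : nat -> T -> R) (s : nat -> R) (C q r : R) :
  (forall k w, (0 <= f k w)%R) -> (forall k, has_mean (f k) (s k)) ->
  (0 < q)%R -> (forall k, (s k <= C * q ^+ k)%R) -> (q < r)%R ->
  {ae P, forall w, exists K, forall k, (K <= k)%N -> (f k w <= r ^+ k)%R}.
Proof.
move=> f0 fs q0 sC qr; have r0 := lt_trans q0 qr.
pose F k := [set w | (r ^+ k < f k w)%R].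
have mF k : measurable (F k).
  rewrite /F -[X in measurable X]setTI; apply: measurable_fun_ltr => //.
  exact: has_mean_measurable (fs k).
(* Read off at k = 0, where the mean is nonnegative and bounded by C; needed to bound partial
   geometric sums by the full sum. *)
have C0 : (0 <= C)%R.
  have := sC 0%N; rewrite expr0 mulr1; apply: le_trans.
  exact: has_mean_le (f0 0%N) (has_mean_cst 0) (fs 0%N).
have x1 : (`|q / r| < 1)%R.
  by rewrite gtr0_norm ?divr_gt0// ltr_pdivrMr// mul1r.
have sumF : \sum_(k <oo) P (F k) <= (C / (1 - q / r))%:E.
  apply: lime_le; first exact: is_cvg_nneseries.
  apply: nearW => N.
  apply: (@le_trans _ _ (\sum_(0 <= k < N) (geometric C (q / r) k)%:E)).
    apply: lee_sum => k _; apply: le_trans (has_mean_tail_le (f0 k) (fs k) _) _.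
      exact: exprn_gt0.
    rewrite lee_fin /= expr_div_n mulrA ler_pM2r ?invr_gt0 ?exprn_gt0//.
  rewrite sumEFin lee_fin; apply: geometric_le_lim => //.
  exact: divr_gt0.
have lim0 : P (lim_sup_set F) = 0.
  by apply: lim_sup_set_cvg0 => //; rewrite (le_lt_trans sumF)// ltry.
exists (lim_sup_set F); split => //.
  apply: bigcap_measurable => // k _.
  by apply: bigcup_measurable => j _.
move=> w /= H; apply: contrapT => Hw; apply: H.
apply: contrapT => Hk; apply: Hw => N _; apply: contrapT => HN; apply: Hk.
exists N => k Nk; rewrite leNgt; apply/negP => fk; apply: HN.
by exists k.
Qed.

End mean.

(** * From geometric decay to the exponential rate, and its limit *)

Section exponential_rate.
Local Open Scope ereal_scope.
Context (R : realType).

Lemma limn_esup_le_eventually (u : nat -> \bar R) (K : nat) (l : \bar R) :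
  (forall k, (K <= k)%N -> u k <= l) -> limn_esup u <= l.
Proof.
move=> ul; rewrite /limn_esup limf_esupE; apply: ge_ereal_inf.
exists (ereal_sup [set u k | k in [set k | (K <= k)%N]]).
  by exists [set k | (K <= k)%N] => //; exists K.
by apply: ge_ereal_sup => _ [k Kk <-]; exact: ul.
Qed.

Lemma limn_esup_lne_le (x : nat -> R) (r Delta : R) (K : nat) :
  (0 < r)%R -> (0 < Delta)%R -> (forall k, (K <= k)%N -> (x k <= r ^+ k)%R) ->
  limn_esup (fun k => ((k%:R * Delta)^-1)%:E * lne (x k)%:E) <=
  (ln r / Delta)%:E.
Proof.
(* Starting at [K.+1] excludes k = 0, where the factor 1 / (k Delta) is not positive. *)
move=> r0 D0 xr; apply: (@limn_esup_le_eventually _ K.+1) => k Kk.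
have k0 : (0 < k%:R :> R)%R by rewrite ltr0n (leq_trans _ Kk).
have kD : (0 < (k%:R * Delta)^-1)%R by rewrite invr_gt0 mulr_gt0.
(* Here the logarithm is -oo, in accordance with log 0 = -oo, and the bound is trivial. *)
have [x0|x0] := leP (x k) 0%R.
  by rewrite le0_lneNy ?lee_fin// gt0_muleNy ?leNye.
rewrite lne_EFin// -EFinM lee_fin.
apply: (@le_trans _ _ ((k%:R * Delta)^-1 * (k%:R * ln r))%R).
  rewrite ler_pM2l// mulr_natl -lnXn// ler_ln ?posrE ?exprn_gt0//.
  by apply: xr; exact: ltnW.
by rewrite invfM mulrACA mulVf ?gt_eqF// mul1r mulrC.
Qed.

Lemma ae_exponential_rate d (T : measurableType d) (P : probability T R)
    (f : nat -> T -> R) (s : nat -> R) (C q Delta : R) :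
  (forall k w, (0 <= f k w)%R) -> (forall k, has_mean P (f k) (s k)) ->
  (0 < q)%R -> (forall k, (s k <= C * q ^+ k)%R) -> (0 < Delta)%R ->
  {ae P, forall w,
    limn_esup (fun k => ((k%:R * Delta)^-1)%:E * lne (f k w)%:E) <=
    (ln q / Delta)%:E}.
Proof.
move=> f0 fs q0 sC D0.
(* The rates q (1 + 1/(l+1)) decrease to q and are countably many, so one null set serves them all.
   Their loss in the exponent is at most 1/((l+1) Delta), because ln(1 + x) <= x. *)
have ev : {ae P, forall w, forall l : nat,
    exists K, forall k, (K <= k)%N -> (f k w <= (q * (1 + l.+1%:R^-1)) ^+ k)%R}.
  apply: ae_foralln => l; apply: (ae_eventually_le f0 fs q0 sC).
  by rewrite ltr_pMr// ltrDl invr_gt0.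
apply: filterS ev => w ev; apply/lee_addgt0Pr => e e0.
have [l le] : exists l : nat, (l.+1%:R^-1 <= e * Delta)%R.
  have eD : (0 < (e * Delta)^-1)%R by rewrite invr_gt0 mulr_gt0.
  exists (Num.truncn (e * Delta)^-1).
  rewrite -[leRHS]invrK lef_pV2 ?posrE//.
  by rewrite ltW// truncnS_gt.
have [K HK] := ev l.
have l0 : (0 < 1 + l.+1%:R^-1 :> R)%R by rewrite addr_gt0// invr_gt0.
apply: le_trans (limn_esup_lne_le _ D0 HK) _; first by rewrite mulr_gt0.
rewrite -EFinD lee_fin lnM ?posrE// mulrDl lerD2l ler_pdivrMr//.
apply: le_trans _ le; rewrite -[leRHS]expRK ler_ln ?posrE ?expR_gt0//.
exact: expR_ge1Dx.
Qed.

(** Caratheodory's form of the derivative at 1, ln y = g(y) (y - 1) with g continuous at 1 and g(1)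
    = 1, turns the quotient into c g(1 + c x). *)
Lemma cvg_ln1Dx_div (c : R) :
  (ln (1 + c * x) / x)%R @[x --> 0^'+] --> c.
Proof.
have /is_derive1_caratheodory[g [gE gc g1]] : is_derive (1%R : R) 1%R (@ln R) 1%R.
  by rewrite -[X in is_derive _ _ _ X]invr1; exact: is_derive1_ln.
have lin : (1 + c * x)%R @[x --> (0%R : R)] --> (1%R : R).
  have : (1 + c * x)%R @[x --> (0%R : R)] --> (1 + c * 0)%R.
    apply: cvgD; first exact: cvg_cst.
    by apply: cvgM; [exact: cvg_cst|exact: cvg_id].
  by rewrite mulr0 addr0.
have lim : (c * g (1 + c * x))%R @[x --> 0^'+] --> c.
  have : (c * g (1 + c * x))%R @[x --> 0^'+] --> (c * g 1)%R.
    apply: cvgM; first exact: cvg_cst.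
    apply: cvg_at_right_filter.
    exact: (cvg_comp (fun x => 1 + c * x)%R g lin gc).
  by rewrite g1 mulr1.
apply: cvg_trans lim; apply: near_eq_cvg; near=> x.
have x0 : (x != 0)%R by rewrite gt_eqF//; near: x; exact: nbhs_right_gt.
have := gE (1 + c * x)%R; rewrite ln1 subr0 addrAC subrr add0r => ->.
by field.
Unshelve. all: by end_near. Qed.

Lemma cvg_log_rate (a c : R) :
  ((ln (1 + c * x) - ln (1 + a * x)) / x)%R @[x --> 0^'+] --> (c - a)%R.
Proof.
under eq_fun do rewrite mulrBl.
by apply: cvgB; exact: cvg_ln1Dx_div.
Qed.

End exponential_rate.

(** * The mean square recursion of the scheme *)

Section scheme_moments.
Local Open Scope ereal_scope.
Context (R : realType) (disp : measure_display) (Omega : measurableType disp)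
  (P : probability Omega R) (F : R -> set (set Omega)) (d m n : nat)
  (b : 'cV[R]_d -> P2 R d -> 'cV[R]_d)
  (sigma : 'cV[R]_d -> P2 R d -> 'M[R]_(d, m))
  (X0 : Omega -> 'cV[R]_d) (W : R -> Omega -> 'cV[R]_m)
  (X0c : 'I_n.+1 -> Omega -> 'cV[R]_d) (Wc : 'I_n.+1 -> R -> Omega -> 'cV[R]_m)
  (K1 K2 c1 c2 h1 h2 Delta : R) (Z : nat -> 'I_n.+1 -> Omega -> 'cV[R]_d).
Hypothesis hF : usual_conditions P F.
Hypothesis hX0_meas : measurable_wrt (F 0%R) X0.
Hypothesis hX0_mom : \int[P]_w (frob (X0 w) ^+ 2)%:E < +oo.
Hypothesis hW : brownian_motion P F W.
Hypothesis hcopies : independent_copies P W X0 Wc X0c.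
Hypothesis sigma_lip : forall mu, locally_lipschitz (sigma ^~ mu).
Hypotheses (K1_ge0 : (0 <= K1)%R) (K2_ge0 : (0 <= K2)%R) (Delta_gt0 : (0 < Delta)%R).
Hypotheses (c1_ge0 : (0 <= c1)%R) (c2_ge0 : (0 <= c2)%R)
  (h1_ge0 : (0 <= h1)%R) (h2_ge0 : (0 <= h2)%R).
Hypothesis mono : forall (x y : 'cV[R]_d) (mu nu : P2 R d),
  (2 * dot (x - y) (b x mu - b y nu) + frob (sigma x mu - sigma y nu) ^+ 2
  <= - K1 * frob (x - y) ^+ 2 + K2 * W2 mu nu ^+ 2)%R.
Hypothesis drift : forall (x : 'cV[R]_d) (mu : P2 R d),
  (2 * dot x (b x mu)
  <= - c1 * frob x ^+ 2 + c2 * second_moment_norm mu ^+ 2)%R.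
Hypothesis diffusion : forall (x : 'cV[R]_d) (mu : P2 R d),
  (m%:R * frob (sigma x mu) ^+ 2
  <= h1 * frob x ^+ 2 + h2 * second_moment_norm mu ^+ 2)%R.
Hypothesis scheme : backward_EM P b sigma Wc X0c Delta Z.

Definition mean_square (k : nat) (w : Omega) : R :=
  (n.+1%:R^-1 * \sum_i frob (Z k i w) ^+ 2)%R.

Local Notation mu k w := (empirical (fun i => Z k i w)).

Local Notation obs t := (g_sigma_algebraType (observable P X0c Wc t)).

Let second_moment k w :
  (second_moment_norm (mu k w) ^+ 2 = mean_square k w)%R.
Proof. exact: sqr_second_moment_norm_empirical. Qed.

Lemma mean_square_ge0 k w : (0 <= mean_square k w)%R.
Proof. by rewrite mulr_ge0// ?invr_ge0// sumr_ge0// => i _; exact: sqr_ge0. Qed.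

Let sqr_frob_le_mean k i w :
  (frob (Z k i w) ^+ 2 <= n.+1%:R * mean_square k w)%R.
Proof.
rewrite /mean_square mulrA divff// mul1r (bigD1 i)//= lerDl.
by rewrite sumr_ge0// => j _; exact: sqr_ge0.
Qed.

Let measurable_sqr_frob_Z k i :
  measurable_fun setT (fun w => frob (Z k i w) ^+ 2)%R.
Proof.
have [mZ _ _] := scheme.
exact: (measurableT_comp (@measurable_sqr_frob R d 1) (mZ k i)).
Qed.

Lemma measurable_mean_square k : measurable_fun setT (mean_square k).
Proof.
apply: measurable_funM => //; apply: measurable_sum => i.
exact: measurable_sqr_frob_Z.
Qed.

Let integrable_dominated (f g : Omega -> R) : measurable_fun setT f ->
  (forall w, (0 <= f w <= g w)%R) -> P.-integrable setT (EFin \o g) ->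
  P.-integrable setT (EFin \o f).
Proof.
move=> mf fg gi; apply: (@le_integrable _ _ _ P setT _ _ (EFin \o g)) => //.
  exact/measurable_EFinP.
move=> w _; have /andP[f0 fgw] := fg w.
by rewrite /= lee_fin !ger0_norm// (le_trans f0).
Qed.

(** Each particle is dominated by n + 1 times the average, so it has its own second moment. No
    exchangeability is invoked: only the average of these moments enters the recursion. *)
Let weighted_mean (k : nat) (s : R) : has_mean P (mean_square k) s ->
  exists2 z : 'I_n.+1 -> R,
    forall i, has_mean P (fun w => frob (Z k i w) ^+ 2)%R (z i) &
    (n.+1%:R^-1 * \sum_i z i)%R = s.
Proof.
move=> Ss.
have /choice[z Hz] i : exists z, has_mean P (fun w => frob (Z k i w) ^+ 2)%R z.
  apply: integrable_has_mean; apply: (@integrable_dominated _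
    (fun w => n.+1%:R * mean_square k w)%R) => //.
    by move=> w; rewrite sqr_ge0 sqr_frob_le_mean.
  by case: (has_meanZ n.+1%:R Ss).
exists z => //; apply: (has_mean_unique _ Ss).
exact: has_meanZ (has_mean_sum Hz).
Qed.

Let t_ge0 (k : nat) : (0 <= k%:R * Delta)%R.
Proof. by rewrite mulr_ge0// ltW. Qed.

Let t_lt (k : nat) : (k%:R * Delta < k.+1%:R * Delta)%R.
Proof. by rewrite ltr_pM2r// ltr_nat. Qed.

Let dW k i l := increment Wc (k%:R * Delta) (k.+1%:R * Delta) i l.
Let sg k i a l w := sigma (Z k i w) (mu k w) a l.

Lemma mean_square_step (k : nat) (s : R) : has_mean P (mean_square k) s ->
  exists2 s', has_mean P (mean_square k.+1) s' &
    ((1 + c1 * Delta) * s' <= (1 + (c2 + h1 + h2) * Delta) * s)%R.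
Proof.
move=> Ss; have [z Hz zs] := weighted_mean Ss.
have oZ i a : measurable_fun (setT : set (obs (k%:R * Delta)%R))
    (fun w => Z k i w a 0%R).
  exact: (measurable_scheme_observable sigma_lip K1_ge0 K2_ge0 Delta_gt0 mono).
have osg i a l : measurable_fun (setT : set (obs (k%:R * Delta)%R)) (sg k i a l).
  exact: (measurable_diffusion_observable sigma_lip K2_ge0 mono oZ).
have m_of_obs (f : Omega -> R) :
    measurable_fun (setT : set (obs (k%:R * Delta)%R)) f ->
    measurable_fun setT f.
  exact: (measurable_observable_measurable hF hcopies).
have sg_le i a l w : (sg k i a l w ^+ 2 <=
    h1 * frob (Z k i w) ^+ 2 + h2 * mean_square k w)%R.
  rewrite -second_moment; apply: le_trans (diffusion _ _).
  apply: le_trans (ler_sqr_frob _ a l) _.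
  (* The index [l : 'I_m] witnesses 1 <= m. *)
  by rewrite ler_peMl ?sqr_ge0// ler1n (leq_trans _ (ltn_ord l)).
have mean_bound i : has_mean P
    (fun w => h1 * frob (Z k i w) ^+ 2 + h2 * mean_square k w)%R
    (h1 * z i + h2 * s)%R.
  by apply: has_meanD; apply: has_meanZ.
have /choice[e He] (ial : 'I_n.+1 * 'I_d * 'I_m) : exists e,
    has_mean P (fun w => sg k ial.1.1 ial.1.2 ial.2 w ^+ 2)%R e.
  case: ial => [[i a] l]; apply: integrable_has_mean.
  apply: (integrable_dominated _ _ (mean_bound i).1).
    by apply: measurable_funX; apply: m_of_obs; exact: osg.
  by move=> w; rewrite sqr_ge0/=; exact: sg_le.
have e0 ial : (0 <= e ial)%R.
  by apply: has_mean_le (has_mean_cst P 0) (He ial) => w; exact: sqr_ge0.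
have e_le i : (m%:R * \sum_a \sum_l e (i, a, l) <= h1 * z i + h2 * s)%R.
  apply: has_mean_le (mean_bound i); last first.
    apply: has_meanZ; apply: has_mean_sum => a; apply: has_mean_sum => l.
    exact: (He (i, a, l)).
  by move=> w; rewrite -second_moment /= -sqr_frob.
have /choice[v Hv] (il : 'I_n.+1 * 'I_m) : exists v,
    has_mean P (fun w => dW k il.1 il.2 w ^+ 2)%R v /\ (v <= Delta)%R.
  have dWi := integrable_sqr_increment hW hcopies il.1 il.2 (t_ge0 k) (t_lt k).
  have [v Hv] := integrable_has_mean dWi; exists v; split=> //.
  rewrite -lee_fin -Hv.2.
  apply: le_trans
    (integral_sqr_increment_le hW hcopies il.1 il.2 (t_ge0 k) (t_lt k)) _.
  by rewrite lee_fin -mulrBl -natrB// subSnn mul1r.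
have dW0 i l : has_mean P (dW k i l) 0%R.
  split; first exact: (integrable_increment hW hcopies i l (t_ge0 k) (t_lt k)).
  exact: (integral_increment0 hW hcopies i l (t_ge0 k) (t_lt k)).
have indep i l (f : Omega -> R) :
    measurable_fun (setT : set (obs (k%:R * Delta)%R)) f ->
    independent_rv P f (dW k i l).
  exact: (increment_independent hF hX0_meas hW hcopies i l (t_ge0 k) (t_lt k)).
(* The observable factor Z sigma is integrable because |Z sigma| <= Z^2 + sigma^2; the increment is
   centred and independent of it. *)
have cross i a l : has_mean P
    (fun w => Z k i w a 0%R * sg k i a l w * dW k i l w)%R 0%R.
  have oX := measurable_funM (oZ i a) (osg i a l).
  have [x Hx] : exists x, has_mean P (fun w => Z k i w a 0%R * sg k i a l w)%R x.
    apply: integrable_has_mean.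
    apply: (@le_integrable _ _ _ P setT _ _ (EFin \o (fun w =>
      frob (Z k i w) ^+ 2 + (h1 * frob (Z k i w) ^+ 2 + h2 * mean_square k w))%R)) => //.
    - by apply/measurable_EFinP; exact: m_of_obs.
    - move=> w _; rewrite /= lee_fin.
      have := sg_le i a l w; have := ler_sqr_frob (Z k i w) a 0%R.
      have := sqr_ge0 (Z k i w a 0%R - sg k i a l w).
      have := sqr_ge0 (Z k i w a 0%R + sg k i a l w).
      have := sqr_ge0 (sg k i a l w); have := sqr_ge0 (Z k i w a 0%R).
      rewrite sqrrB sqrrD => A1 A2 A3 A4 A5 A6.
      rewrite [leRHS]ger0_norm; last by nra.
      by rewrite ler_norml; apply/andP; split; nra.
    - by case: (has_meanD (Hz i) (mean_bound i)).
  by apply: has_mean_independentM0 Hx (dW0 i l); exact: indep.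
have square i a l : has_mean P
    (fun w => sg k i a l w ^+ 2 * dW k i l w ^+ 2)%R (e (i, a, l) * v (i, l))%R.
  apply: has_mean_independentM (He (i, a, l)) (Hv (i, l)).1.
  apply: (@independent_rv_comp _ _ _ _ _ _ (fun x => x ^+ 2)%R (fun x => x ^+ 2)%R).
  - exact: measurable_funX.
  - exact: measurable_funX.
  - by apply: indep; exact: osg.
(* An upper bound of 2 <Z, sigma dW> + |sigma dW|^2 in which every term is an observable factor
   times a function of one coordinate increment. *)
pose G i w := (2 * (\sum_a \sum_l Z k i w a 0 * sg k i a l w * dW k i l w) +
  m%:R * \sum_a \sum_l sg k i a l w ^+ 2 * dW k i l w ^+ 2)%R.
have HG i : has_mean P (G i) (2 * (\sum_(a < d) \sum_(l < m) 0) +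
    m%:R * \sum_a \sum_l e (i, a, l) * v (i, l))%R.
  by apply: has_meanD; apply: has_meanZ; apply: has_mean_sum => a;
    apply: has_mean_sum => l; [exact: cross|exact: square].
have HRHS := has_meanD (has_meanZ (1 + c2 * Delta) Ss)
  (has_meanZ n.+1%:R^-1 (has_mean_sum HG)).
have D1 : (0 < 1 + c1 * Delta)%R.
  by rewrite ltr_pwDl// mulr_ge0// ltW.
(* The existence of the mean at step k + 1 and its bound are obtained together. *)
have [] := @has_mean_dominated _ _ _ P
  (fun w => (1 + c1 * Delta) * mean_square k.+1 w)%R _ _ _ _ _ HRHS.
- by apply: measurable_funM => //; exact: measurable_mean_square.
- by move=> w; rewrite mulr_ge0 ?mean_square_ge0// ltW.
- have [_ _ /(_ k) ZS] := scheme.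
  (* The finitely many almost sure equations are merged as a sequence, indexed through [inord]. *)
  have {}ZS : {ae P, forall w, forall i : nat,
      Z k.+1 (inord i) w = (Z k (inord i) w +
        Delta *: b (Z k.+1 (inord i) w) (mu k w) +
        sigma (Z k (inord i) w) (mu k w) *m
        (Wc (inord i) (k.+1%:R * Delta) w - Wc (inord i) (k%:R * Delta) w))%R}.
    by apply: ae_foralln => i; exact: (ZS (inord i)).
  apply: filterS ZS => w ZS.
  have step (i : 'I_n.+1) : ((1 + c1 * Delta) * frob (Z k.+1 i w) ^+ 2 <=
      frob (Z k i w) ^+ 2 + c2 * Delta * mean_square k w + G i w)%R.
    have := ZS i; rewrite inord_val; set dWi := (_ - _)%R => ZSi.
    have {}ZSi : Z k.+1 i w = (Z k i w + sigma (Z k i w) (mu k w) *m dWi +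
        Delta *: b (Z k.+1 i w) (mu k w))%R.
      by rewrite {1}ZSi -!addrA; congr (_ + _)%R; rewrite addrC.
    have := implicit_step_dissipative (ltW Delta_gt0) (drift _ _) ZSi.
    move=> /le_trans; apply; rewrite second_moment sqr_frobD.
    have -> : dot (Z k i w) (sigma (Z k i w) (mu k w) *m dWi) =
        (\sum_a \sum_l Z k i w a 0 * sg k i a l w * dW k i l w)%R.
      apply: eq_bigr => a _; rewrite mxE mulr_sumr; apply: eq_bigr => l _.
      by rewrite mulrA.
    have := sqr_frob_mulmx_le (sigma (Z k i w) (mu k w)) dWi.
    rewrite /G -/(sg k i _ _ w).
    set A := (\sum_a \sum_l _ * _)%R; set B := (m%:R * _)%R.
    lra.
  rewrite /mean_square mulrCA mulr_sumr.
  apply: (@le_trans _ _ (n.+1%:R^-1 * \sum_i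
    (frob (Z k i w) ^+ 2 + c2 * Delta * mean_square k w + G i w))%R).
    by rewrite ler_wpM2l ?invr_ge0//; apply: ler_sum => i _; exact: step.
  rewrite !big_split/= !mulrDr sumr_const card_ord -/(mean_square k w).
  have -> : (n.+1%:R^-1 * (c2 * Delta * mean_square k w *+ n.+1) =
      c2 * Delta * mean_square k w)%R.
    by rewrite -(mulr_natl (c2 * Delta * mean_square k w)%R) mulKf.
  by rewrite mulrDl mul1r.
- move=> u' Hu' u'le.
  exists ((1 + c1 * Delta)^-1 * u')%R.
    have := has_meanZ (1 + c1 * Delta)^-1 Hu'.
    congr (has_mean _ _ _); apply/funext => w.
    by rewrite mulrA mulVf ?mul1r// gt_eqF.
  rewrite mulrA divff ?gt_eqF// mul1r; apply: (le_trans u'le).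
  have sum0 : (\sum_(a < d) \sum_(l < m) (0 : R) = 0)%R.
    by apply: big1 => a _; exact: big1.
  (* The cross terms have mean zero, and each increment contributes v <= Delta, which leaves Delta
     times the bound of the diffusion condition. *)
  have Gi_le i : (2 * (\sum_(a < d) \sum_(l < m) 0) +
      m%:R * \sum_a \sum_l e (i, a, l) * v (i, l) <=
      Delta * (h1 * z i + h2 * s))%R.
    rewrite sum0 mulr0 add0r.
    apply: (@le_trans _ _ (Delta * (m%:R * \sum_a \sum_l e (i, a, l)))%R).
      rewrite mulrCA ler_wpM2l// mulr_sumr; apply: ler_sum => a _.
      rewrite mulr_sumr; apply: ler_sum => l _.
      by rewrite mulrC ler_wpM2r//; case: (Hv (i, l)).
    by rewrite ler_wpM2l// ltW.
  apply: (@le_trans _ _ ((1 + c2 * Delta) * s + n.+1%:R^-1 *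
      \sum_(i < n.+1) Delta * (h1 * z i + h2 * s))%R).
    by rewrite lerD2l ler_wpM2l ?invr_ge0//; apply: ler_sum => i _.
  rewrite -mulr_sumr big_split/= -mulr_sumr sumr_const card_ord.
  have -> : (\sum_i z i = n.+1%:R * s)%R by rewrite -zs mulrA divff// mul1r.
  rewrite -mulr_natl.
  have n0 : (n.+1%:R != 0 :> R)%R by [].
  by rewrite le_eqVlt; apply/orP; left; apply/eqP; field.
Qed.

Let init_event (B : set R) : measurable B ->
  path_events [set w : (R -> 'cV[R]_m) * 'cV[R]_d | B (frob w.2 ^+ 2)%R].
Proof.
move=> mB; apply: sub_sigma_algebra; right.
exists [set x : 'cV[R]_d | B (frob x ^+ 2)%R] => //.
by rewrite -[X in measurable X]setTI; exact: measurable_sqr_frob.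
Qed.

(** |X_0^j|^2 has the law of |X_0|^2, as seen from path events on the initial value alone, and Z_0
    equals X_0^j almost surely. *)
Lemma mean_square_init : exists s, has_mean P (mean_square 0) s.
Proof.
have [law _ _] := hcopies; have [_ Z0 _] := scheme.
have mX0c i : measurable_fun setT (fun w => frob (X0c i w) ^+ 2)%R.
  by move=> _ B mB; rewrite setTI; case: (law i _ (init_event mB)).
have mX0 : measurable_fun setT (fun w => frob (X0 w) ^+ 2)%R.
  apply: (measurableT_comp (@measurable_sqr_frob R d 1)) => _ B mB.
  have [_ /(_ 0%R (lexx _))[_ FM] _ _ _] := hF.
  by rewrite setTI; apply: FM; exact: hX0_meas.
have mabs : measurable_fun setT (fun x : R => `|x|%:E).
  by apply/measurable_EFinP; exact: normr_measurable.
have X0cE i : \int[P]_w (frob (X0c i w) ^+ 2)%:E = \int[P]_w (frob (X0 w) ^+ 2)%:E.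
  pose Y : {RV P >-> R} := mfun_Sub (mem_set (mX0c i)).
  pose Y' : {RV P >-> R} := mfun_Sub (mem_set mX0).
  transitivity (\int[distribution P Y]_x `|x|%:E).
    rewrite ge0_integral_distribution//; apply: eq_integral => w _ /=.
    by rewrite ger0_norm// sqr_ge0.
  transitivity (\int[distribution P Y']_x `|x|%:E).
    apply: eq_measure_integral => B mB _.
    by case: (law i _ (init_event mB)).
  rewrite ge0_integral_distribution//; apply: eq_integral => w _ /=.
  by rewrite ger0_norm// sqr_ge0.
have /choice[z Hz] i : exists z, has_mean P (fun w => frob (Z 0%N i w) ^+ 2)%R z.
  apply: integrable_has_mean; apply/integrableP; split.
    by apply/measurable_EFinP; exact: measurable_sqr_frob_Z.
  under eq_integral do rewrite gee0_abs ?lee_fin ?sqr_ge0//.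
  rewrite (_ : integral _ _ _ = \int[P]_w (frob (X0 w) ^+ 2)%:E)// -(X0cE i).
  apply: ge0_ae_eq_integral => //.
  - by apply/measurable_EFinP; exact: measurable_sqr_frob_Z.
  - exact/measurable_EFinP.
  - by move=> w _; rewrite lee_fin sqr_ge0.
  - by move=> w _; rewrite lee_fin sqr_ge0.
  - by apply: filterS (Z0 i) => w Zw _ /=; rewrite Zw.
by eexists; exact: has_meanZ (has_mean_sum Hz).
Qed.

Let rate := ((1 + (c2 + h1 + h2) * Delta) / (1 + c1 * Delta))%R.

Lemma mean_square_geometric : exists C, exists2 s : nat -> R,
  forall k, has_mean P (mean_square k) (s k) &
  forall k, (s k <= C * rate ^+ k)%R.
Proof.
have [C HC] := mean_square_init.
have D1 : (0 < 1 + c1 * Delta)%R by rewrite ltr_pwDl// mulr_ge0// ltW.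
suff /choice[s Hs] : forall k, exists s,
    has_mean P (mean_square k) s /\ (s <= C * rate ^+ k)%R.
  by exists C, s => k; have [] := Hs k.
elim=> [|k [s [Hs sC]]]; first by exists C; rewrite expr0 mulr1.
have [s' Hs' ss'] := mean_square_step Hs; exists s'; split=> //.
rewrite exprS mulrCA {1}/rate mulrAC ler_pdivlMr// mulrC.
apply: (le_trans ss'); apply: ler_wpM2l => //.
by rewrite addr_ge0// mulr_ge0 ?(ltW Delta_gt0)// !addr_ge0.
Qed.

Lemma mean_square_rate : {ae P, forall w,
  limn_esup (fun k => ((k%:R * Delta)^-1)%:E * lne (mean_square k w)%:E) <=
  (- ((ln (1 + c1 * Delta) - ln (1 + (c2 + h1 + h2) * Delta)) / Delta))%:E}.
Proof.
have [C [s Hs sC]] := mean_square_geometric.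
have A0 : (0 < 1 + (c2 + h1 + h2) * Delta)%R.
  by rewrite ltr_pwDl// mulr_ge0 ?(ltW Delta_gt0)// !addr_ge0.
have D1 : (0 < 1 + c1 * Delta)%R by rewrite ltr_pwDl// mulr_ge0// ltW.
have rate0 : (0 < rate)%R by rewrite divr_gt0.
rewrite -mulNr opprB -ln_div ?posrE//.
exact: (ae_exponential_rate mean_square_ge0 Hs rate0 sC).
Qed.

End scheme_moments.

Unset Implicit Arguments.
Set Strict Implicit.

Theorem theorem5p5 (R : realType) (disp : measure_display)
    (Omega : measurableType disp) (P : probability Omega R)
    (F : R -> set (set Omega)) (d m n : nat)
    (b : 'cV[R]_d -> P2 R d -> 'cV[R]_d)
    (sigma : 'cV[R]_d -> P2 R d -> 'M[R]_(d, m))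
    (X0 : Omega -> 'cV[R]_d) (W : R -> Omega -> 'cV[R]_m)
    (X0c : 'I_n.+1 -> Omega -> 'cV[R]_d) (Wc : 'I_n.+1 -> R -> Omega -> 'cV[R]_m)
    (K1 K2 C c1 c2 h1 h2 : R)
    (hF : usual_conditions P F)
    (hb_meas : measurable_fun setT (fun z : 'cV[R]_d * P2 R d => b z.1 z.2))
    (hs_meas : measurable_fun setT (fun z : 'cV[R]_d * P2 R d => sigma z.1 z.2))
    (hb_lip : forall mu, locally_lipschitz (b ^~ mu))
    (hs_lip : forall mu, locally_lipschitz (sigma ^~ mu))
    (hX0_meas : measurable_wrt (F 0) X0)
    (hX0_neq0 : ~ {ae P, forall omega, X0 omega = 0})
    (hX0_mom : forall p : R, 2 <= p ->
       (\int[P]_omega (frob (X0 omega) `^ p)%:E < +oo)%E)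
    (hW : brownian_motion P F W)
    (hcopies : independent_copies P W X0 Wc X0c)
    (hK1 : 0 < K1) (hK2 : 0 < K2)
    (hmono : forall (x y : 'cV[R]_d) (mu nu : P2 R d),
       2 * dot (x - y) (b x mu - b y nu) + frob (sigma x mu - sigma y nu) ^+ 2
       <= - K1 * frob (x - y) ^+ 2 + K2 * W2 mu nu ^+ 2)
    (hC : 0 < C)
    (hbound : forall mu, frob (b 0 mu) + frob (sigma 0 mu) <= C)
    (hc1 : 0 < c1) (hc2 : 0 < c2) (hh1 : 0 < h1) (hh2 : 0 < h2)
    (hdrift : forall (x : 'cV[R]_d) (mu : P2 R d),
       2 * dot x (b x mu)
       <= - c1 * frob x ^+ 2 + c2 * second_moment_norm mu ^+ 2)
    (hdiff : forall (x : 'cV[R]_d) (mu : P2 R d),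
       m%:R * frob (sigma x mu) ^+ 2
       <= h1 * frob x ^+ 2 + h2 * second_moment_norm mu ^+ 2)
    (hconst : h1 + c2 + h2 < c1) :
  exists (Delta0 : R) (beta : R -> R),
    [/\ 0 < Delta0 < 1,
        beta x @[x --> 0^'+] --> c1 - h1 - c2 - h2
      & forall M : nat, (0 < M)%N -> let Delta : R := M%:R^-1 in
        Delta < Delta0 ->
        forall Z : nat -> 'I_n.+1 -> Omega -> 'cV[R]_d,
          backward_EM P b sigma Wc X0c Delta Z ->
          {ae P, forall omega,
            (limn_esup (fun k : nat =>
               ((k%:R * Delta)^-1)%:E *
               lne ((n.+1%:R^-1 * \sum_(i < n.+1) frob (Z k i omega) ^+ 2)%:E))
             <= (- beta Delta)%:E)%E}].
Proof.
have X0_square : (\int[P]_w (frob (X0 w) ^+ 2)%:E < +oo)%E.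
  have := hX0_mom 2 (lexx 2); congr (_ < _)%E; apply: eq_integral => w _.
  by rewrite (powR_mulrn 2 (frob_ge0 (X0 w))).
(* The one-step bound and the recursion hold for every positive stepsize, so the threshold is an
   arbitrary point of (0, 1). *)
exists 2^-1, (fun x => (ln (1 + c1 * x) - ln (1 + (c2 + h1 + h2) * x)) / x).
split.
- by apply/andP; split; lra.
- rewrite [X in _ --> X](_ : _ = c1 - (c2 + h1 + h2)); last by ring.
  exact: cvg_log_rate.
- move=> M M0 Delta _ Z hZ.
  have D0 : 0 < Delta by rewrite invr_gt0 ltr0n.
  exact: (mean_square_rate hF hX0_meas X0_square hW hcopies hs_lip
    (ltW hK1) (ltW hK2) D0 (ltW hc1) (ltW hc2) (ltW hh1) (ltW hh2)
    hmono hdrift hdiff hZ).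
Qed.
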